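(* There exist universal absolute constants $C,C'>0$ such that the following holds. For any $\delta\in(0,1/3]$ there exists an estimator $\widehat\mu_\delta=\widehat\mu_\delta(X_{1:n})$, i.e. a measurable function of the sample that may depend on $n$ and $\delta$ but does not depend on $f$ (nor on $\mu$), such that $$\inf_{\mu\in\mathbb R}\ \mathbb P_{X_1,\dots,X_n\overset{\mathrm{iid}}{\sim} f_\mu}\left(|\widehat\mu_\delta-\mu|\le \omega_f\Big(\frac{C\log(1/\delta)}{n}\Big)\right)\ge 1-\delta\qquad\text{whenever } n\ge C'\log(1/\delta),$$ for every $f\in\mathcal F_{\mathsf{SLC}}$. Moreover, the same conclusion extends to every symmetric unimodal density $f$ with a monotone hazard rate, i.e. to every $f\in\mathcal F_{\mathsf{SUMHR}}$.
   Context: For a probability density $f$ on $\mathbb R$ and $\mu\in\mathbb R$, $f_\mu(x)=f(x-\mu)$. The squared Hellinger divergence is $\mathsf H^2(P,Q)=\frac12\int(\sqrt{dP}-\sqrt{dQ})^2=1-\int\sqrt{dP\,dQ}$. The inverse Hellinger modulus of continuity is $\omega_f(t)=\sup\{r\ge 0:\ \mathsf H^2(f_0,f_{2r})\le t\}$ for $t\in[0,1]$ (the supremum may be $+\infty$). $\mathcal F_{\mathsf{SLC}}$ is the class of symmetric log-concave densities: probability densities $f$ on $\mathbb R$ with $f(x)=f(-x)$ and $\log f:\mathbb R\to[-\infty,+\infty)$ concave. $\mathcal F_{\mathsf{SUMHR}}$ is the class of probability densities $f$ with $f(x)=f(-x)$, $f$ non-increasing on $[0,+\infty)$, and hazard function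 $h_f(x)=f(x)/(1-F(x))$ non-decreasing on the interior of the support $\{f>0\}$, where $F$ is the cumulative distribution function of $f$. *)

(* Defs.v *)
From HB Require Import structures.
From mathcomp Require Import all_boot all_order all_algebra.
From mathcomp Require Import all_classical all_reals all_analysis.
From mathcomp Require Import measurable_realfun.

Set Implicit Arguments.
Unset Strict Implicit.
Unset Printing Implicit Defensive.

Import Order.TTheory GRing.Theory Num.Theory.
Import numFieldNormedType.Exports.

Local Open Scope classical_set_scope.
Local Open Scope ring_scope.

(* Densities are genuine functions, not classes modulo null sets: symmetry,
   log-concavity and monotonicity below are pointwise conditions. *)
Record density (R : realType) := Density {
  pdf :> R -> R ;
  measurable_pdf : measurable_fun [set: R] pdf ;
  pdf_ge0 : forall x, 0 <= pdf x ;
  integral_pdf : (\int[lebesgue_measure]_x (pdf x)%:E = 1)%E }.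

Section translate.
Context {R : realType}.
Variables (mu : R) (f : density R).

Let tr : measurableTypeR R -> measurableTypeR R := fun x => x - mu.

Let measurable_tr : measurable_fun [set: measurableTypeR R] tr.
Proof. by apply: measurable_funB; [exact: measurable_id|exact: measurable_cst]. Qed.

HB.instance Definition _ :=
  @isMeasurableFun.Build _ _ _ _ tr measurable_tr.

Let pushforward_tr (A : set (measurableTypeR R)) : measurable A ->
  pushforward (@lebesgue_measure R) tr A = lebesgue_measure A.
Proof.
move=> mA; apply/esym/lebesgue_measure_unique => //= _ [[a b]] _ <-.
rewrite /pushforward.
have -> : tr @^-1` `]a, b]%classic = [set` `](a + mu), (b + mu)]].
  by apply/seteqP; split=> x /=; rewrite !in_itv/= ltrBrDr lerBlDr.
rewrite !lebesgue_measure_itv/= !lte_fin ltrD2r; case: ifPn => // _.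
by congr EFin; rewrite opprD addrACA subrr addr0.
Qed.

Let measurable_translate : measurable_fun [set: R] (fun x => f (x - mu)).
Proof. exact: measurableT_comp (measurable_pdf f) measurable_tr. Qed.

Let integral_translate :
  (\int[lebesgue_measure]_x (f (x - mu))%:E = 1)%E.
Proof.
have mf : measurable_fun [set: measurableTypeR R] (EFin \o f).
  by apply/measurable_EFinP; exact: (measurable_pdf f).
have f0 (y : measurableTypeR R) : y \in [set: measurableTypeR R] ->
    (0 <= (EFin \o f) y)%E.
  by move=> _; rewrite lee_fin pdf_ge0.
have := @ge0_integral_pushforward _ _ _ _ R tr measurable_tr
  (@lebesgue_measure R) _ (EFin \o f) measurableT mf f0.
rewrite preimage_setT => <-; rewrite -(integral_pdf f).
by apply: eq_measure_integral => A mA _; exact: pushforward_tr.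
Qed.

Definition translate : density R :=
  Density measurable_translate (fun x => pdf_ge0 f (x - mu)) integral_translate.

End translate.

Section density_law.
Context {R : realType}.
Variable f : density R.
Local Open Scope ereal_scope.

Definition density_law (A : set (measurableTypeR R)) : \bar R :=
  \int[lebesgue_measure]_(x in A) (f x)%:E.

Let density_law0 : density_law set0 = 0.
Proof. by rewrite /density_law integral_set0. Qed.

Let density_law_ge0 A : 0 <= density_law A.
Proof. by apply: integral_ge0 => x _; rewrite lee_fin pdf_ge0. Qed.

Let density_law_sigma_additive : semi_sigma_additive density_law.
Proof.
move=> /= F mF tF mUF; rewrite /density_law; apply: cvg_toP.
  apply: ereal_nondecreasing_is_cvgn => m n mn.
  apply: lee_sum_nneg_natr => // k _ _.
  by apply: integral_ge0 => /= x _; rewrite lee_fin pdf_ge0.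
rewrite ge0_integral_bigcup//=.
- by apply: measurable_funTS; apply/measurable_EFinP; exact: measurable_pdf.
- by move=> x _; rewrite lee_fin pdf_ge0.
Qed.

HB.instance Definition _ := isMeasure.Build _ _ _ density_law
  density_law0 density_law_ge0 density_law_sigma_additive.

Let density_lawT : density_law [set: _] = 1.
Proof. exact: integral_pdf. Qed.

HB.instance Definition _ :=
  @Measure_isProbability.Build _ _ R density_law density_lawT.

End density_law.

Section iid.
Context d {T : measurableType d} {R : realType}.

Definition tuple_cons n (x : T * n.-tuple T) : n.+1.-tuple T :=
  [tuple of x.1 :: x.2].

Let measurable_tuple_cons n :
  measurable_fun [set: T * n.-tuple T] (@tuple_cons n).
Proof. exact: measurable_cons. Qed.

HB.instance Definition _ n :=
  @isMeasurableFun.Build _ _ _ _ (@tuple_cons n) (@measurable_tuple_cons n).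

(* The n-fold product measure of P, i.e. the law of n i.i.d. draws from P. *)
Fixpoint iid (P : probability T R) (n : nat) : probability (n.-tuple T) R :=
  match n with
  | 0 => \d_([tuple] : 0.-tuple T)
  | m.+1 => distribution (P \x iid P m)%E (@tuple_cons m)
  end.

Lemma iid_rectangle (P : probability T R) n (A : 'I_n -> set T) :
  (forall i, measurable (A i)) ->
  (iid P n [set x | forall i, A i (tnth x i)] = \prod_(i < n) P (A i))%E.
Proof.
elim: n A => [|n IHn] A mA.
  rewrite big_ord0 /= diracE mem_set//= => -[].
  by [].
rewrite big_ord_recl -(IHn (fun i => A (lift ord0 i)))//.
rewrite /= /distribution /pushforward.
rewrite -product_measure1E//; last first.
  rewrite (_ : [set x | _] = \bigcap_(i in [set: 'I_n])
      ((fun x : n.-tuple T => tnth x i) @^-1` A (lift ord0 i))); last first.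
    by apply/seteqP; split=> x /= Ax i; [move=> _; exact: Ax|exact: Ax].
  apply: fin_bigcap_measurable => // i _; rewrite -[X in measurable X]setTI.
  exact: measurable_tnth.
congr (_ _); apply/seteqP; split=> [[x y]/= Axy|[x y]/= [Ax Ay] i].
  split; first by have := Axy ord0; rewrite tnth0.
  by move=> i; have := Axy (lift ord0 i); rewrite tnthS.
by case: (unliftP ord0 i) => [j|] ->; rewrite ?tnthS ?tnth0.
Qed.

End iid.

Section hellinger.
Context {R : realType}.
Implicit Types f g : density R.
Local Open Scope ereal_scope.

Definition hellinger2 f g : \bar R :=
  (2^-1)%:E * \int[lebesgue_measure]_x
    ((Num.sqrt (f x) - Num.sqrt (g x)) ^+ 2)%:E.

Definition inv_hellinger_modulus f (t : R) : \bar R :=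
  ereal_sup [set r%:E | r in [set r : R | (0 <= r)%R /\
    hellinger2 (translate 0 f) (translate (2 * r) f) <= t%:E]].

End hellinger.

Section classes.
Context {R : realType}.
Implicit Type f : density R.

(* Concavity of a function valued in [-oo, +oo[. At t = 0 and t = 1 the
   convention 0 * -oo = 0 makes the inequality trivial. *)
Definition econcave (g : R -> \bar R) : Prop :=
  forall (x y t : R), 0 <= t <= 1 ->
    (t%:E * g x + (1 - t)%:E * g y <= g (t * x + (1 - t) * y)%R)%E.

(* lne maps 0 to -oo, so log f is -oo off the support. *)
Definition SLC : set (density R) := [set f : density R |
  (forall x, f x = f (- x)) /\ econcave (fun x => lne (f x)%:E)].

Definition density_cdf f (x : R) : R := fine (density_law f `]-oo, x]).

Definition hazard f (x : R) : R := f x / (1 - density_cdf f x).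

Definition SUMHR : set (density R) := [set f : density R |
  let S : set R := [set x | 0 < f x]° in
  [/\ forall x, f x = f (- x),
      forall x y, 0 <= x -> x <= y -> f y <= f x &
      forall x y, S x -> S y -> x <= y -> hazard f x <= hazard f y]].

End classes.

(* Main.v *)
(* Since f is symmetric, |muhat - mu| <= omega_f(t) holds as soon as the true
   density is t-close in squared Hellinger distance to its reflection about
   muhat. Both classes satisfy f(x) S(y) <= f(y) S(x) for 0 <= x <= y, where S
   is the tail of f: the hazard h = f / S is non-decreasing on [0, +oo[.
   Hence the odd extension psi of h, or of any non-decreasing step function
   comparable with it, is a good score: for X ~ f, the mean of - psi(X - r) is
   at least of order r * E[psi(X - r)^2], so that a Chernoff bound for the sign
   of sum_i psi(X_i - th) at th = mu + r has an exponent of order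
   n r^2 E[h^2]. Up to the mass of the extreme tail, this is also an upper
   bound for n H^2(f_0, f_2r).
   On the quantile scale S = 16^-j, the hazard is comparable with the inverse of
   the gap between consecutive quantiles. The gaps are estimated from one half
   of the sample, at all levels whose mass exceeds a multiple of log(1/delta)/n;
   the failure probabilities of these levels decay so fast that no logarithm
   is lost in the union bound. The other half of the sample is centred by
   solving sum_i psi(X_i - th) = 0. If r is too large for the comparison
   between gaps and hazard, the exponent at a smaller r is already large
   enough, and psi is monotone. *)

Require Import Defs.
From HB Require Import structures.
From mathcomp Require Import all_boot all_order all_algebra.
From mathcomp Require Import all_classical all_reals all_analysis.
From mathcomp Require Import measurable_realfun.
From mathcomp Require Import ring lra zify.
Import Order.TTheory GRing.Theory Num.Theory.
Import numFieldNormedType.Exports.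
Local Open Scope classical_set_scope.
Local Open Scope ring_scope.

Set Implicit Arguments.
Unset Strict Implicit.
Unset Printing Implicit Defensive.

(** * The score attached to a grid of quantiles *)

Section score.
Variable R : realFieldType.

(** Running maximum of the inverse gaps, the stand-in for the hazard. Inverse gaps of estimated
    quantiles need not increase; the maximum makes [score] monotone for every [b], even a degenerate
    one. *)
Fixpoint slope (b : nat -> R) (j : nat) : R :=
  if j is i.+1 then Num.max (slope b i) (b i.+1 - b i)^-1 else 0.

Lemma slope_le (b : nat -> R) j : slope b j <= slope b j.+1.
Proof. by rewrite /= le_max lexx. Qed.

Lemma slope_ge0 (b : nat -> R) j : 0 <= slope b j.
Proof. by elim: j => // j /le_trans; apply; exact: slope_le. Qed.

Lemma slope_homo (b : nat -> R) : {homo slope b : i j / (i <= j)%N >-> i <= j}.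
Proof. by apply: homo_leq => [//|y x z|i]; [exact: le_trans|exact: slope_le]. Qed.

(** On an increasing positive grid, the odd step function with value [slope b j] from [b j] to the
    next point. Writing it by its jumps turns its mean into a sum of tails. *)
Definition score (b : nat -> R) (J : nat) (u : R) : R :=
  \sum_(j < J) (slope b j.+1 - slope b j) *
    ((b j.+1 <= u)%R%:R - (u <= - b j.+1)%R%:R).

Lemma score_homo b J : {homo score b J : u v / u <= v}.
Proof.
move=> u v uv; apply: ler_sum => j _.
apply: ler_wpM2l; first by rewrite subr_ge0 slope_le.
apply: lerB; rewrite ler_nat.
  by case: (leP (b j.+1) u) => // bu; rewrite (le_trans bu uv).
by case: (leP v (- b j.+1)) => // bv; rewrite (le_trans uv bv).
Qed.

Lemma score_le b J u : score b J u <= slope b J.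
Proof.
apply: (@le_trans _ _ (\sum_(j < J) (slope b j.+1 - slope b j))).
  apply: ler_sum => j _; rewrite -[leRHS]mulr1; apply: ler_wpM2l.
    by rewrite subr_ge0 slope_le.
  by case: (_ <= u); case: (u <= _) => /=; lra.
by rewrite -(big_mkord xpredT (fun j => slope b j.+1 - slope b j)) telescope_sumr// subr0.
Qed.

Lemma score_opp b J u : score b J (- u) = - score b J u.
Proof.
rewrite /score -sumrN; apply: eq_bigr => j _.
by rewrite lerNr lerN2 -mulrN opprB.
Qed.

Lemma score_tail b J u :
  (forall j, (j < J)%N -> b j.+1 <= u) -> (forall j, (j < J)%N -> - b j.+1 < u) ->
  score b J u = slope b J.
Proof.
move=> h1 h2; rewrite /score.
rewrite (eq_bigr (fun j : 'I_J => slope b j.+1 - slope b j)); last first.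
  by move=> j _; rewrite h1// [u <= _]leNgt h2// subr0 mulr1.
by rewrite -(big_mkord xpredT (fun j => slope b j.+1 - slope b j)) telescope_sumr// subr0.
Qed.

Lemma incr_upto_le (b : nat -> R) J i j :
    (forall j, (j < J)%N -> b j < b j.+1) -> (i <= j <= J)%N -> b i <= b j.
Proof.
move=> bS; elim: j => [|j IHj]; first by rewrite leqn0 => /andP[/eqP-> _].
move=> /andP[]; rewrite leq_eqVlt => /orP[/eqP-> //|]; rewrite ltnS => ij jJ.
have bij : b i <= b j by apply: IHj; rewrite ij ltnW.
exact: le_trans bij (ltW (bS _ jJ)).
Qed.

(** By induction on [J]: once [u] passes the outermost point on one side it has passed all the
    others there, so the earlier score is [slope b J] up to sign and both sides telescope. *)
Lemma score_sqr_le (b : nat -> R) J u :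
    0 < b 0%N -> (forall j, (j < J)%N -> b j < b j.+1) ->
  score b J u ^+ 2 <= \sum_(j < J) (slope b j.+1 ^+ 2 - slope b j ^+ 2) *
    ((b j.+1 <= u)%R%:R + (u <= - b j.+1)%R%:R).
Proof.
move=> b0; elim: J => [|J IH] bS; first by rewrite /score !big_ord0 expr0n.
have bS' j : (j < J)%N -> b j < b j.+1 by move=> ?; apply: bS; apply: ltnW.
have bm i j : (i <= j <= J.+1)%N -> b i <= b j by exact: incr_upto_le.
have bJ : 0 < b J.+1 by apply: (lt_le_trans b0); apply: bm; rewrite leq0n leqnn.
rewrite big_ord_recr/=; move: (IH bS') => {}IH.
have -> : score b J.+1 u = score b J u + (slope b J.+1 - slope b J) *
    ((b J.+1 <= u)%R%:R - (u <= - b J.+1)%R%:R) by rewrite /score big_ord_recr.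
have := slope_le b J; have := slope_ge0 b J.
set s := slope b J; set s' := Num.max _ _; rewrite -[slope b J.+1]/s' => s0 ss'.
case: (leP (b J.+1) u) => bu.
  have -> : (u <= - b J.+1) = false.
    by apply/negbTE; rewrite -ltNge (lt_le_trans _ bu)// gtrN.
  have e : score b J u = s.
    apply: score_tail => j jJ; first by rewrite (le_trans _ bu)// bm// !ltnS (ltnW jJ) leqnn.
    rewrite (lt_le_trans _ bu)// (@lt_trans _ _ 0)//.
    by rewrite oppr_lt0 (lt_le_trans b0)// bm// leq0n/= ltnS ltnW.
  rewrite e subr0 mulr1 [s + _]addrC subrK addr0 mulr1.
  by rewrite e in IH; rewrite -lerBlDr subKr.
case: (leP u (- b J.+1)) => ub; last by rewrite subrr mulr0 !addr0 mulr0 addr0.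
have e : score b J u = - s.
  rewrite /score (eq_bigr (fun j : 'I_J => - (slope b j.+1 - slope b j))); last first.
    move=> j _.
    have jb : b j.+1 <= b J.+1 by apply: bm; rewrite !ltnS (ltnW (ltn_ord j)) leqnn.
    have -> : (b j.+1 <= u) = false.
      apply/negbTE; rewrite -ltNge (le_lt_trans ub)// (@lt_trans _ _ 0)// ?oppr_lt0//.
      by rewrite (lt_le_trans b0)// bm// leq0n/= ltnS ltnW.
    by rewrite (le_trans ub) ?lerN2// sub0r mulrN1.
  rewrite sumrN -(big_mkord xpredT (fun j => slope b j.+1 - slope b j)) telescope_sumr//.
  by rewrite subr0.
rewrite e in IH *; rewrite sub0r add0r mulr1 mulrN1 -opprD sqrrN [s + _]addrC subrK.
by rewrite sqrrN in IH; rewrite -lerBlDr subKr.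
Qed.

(* [S] plays the role of the tail function [P(X >= x)] of the symmetric
   density [f]; the last condition says that the hazard rate [f / S] is
   non-decreasing, written without division. *)
Definition mhr_tail (f S : R -> R) : Prop :=
  [/\ forall x, 0 <= f x, forall x, 0 <= S x <= 1,
      forall x y, x <= y -> S y <= S x,
      forall x y, 0 <= x -> x <= y -> (y - x) * f y <= S x - S y <= (y - x) * f x &
      forall x y, 0 <= x -> x <= y -> f x * S y <= f y * S x].

(** [level] decreases by factors of 16; tails known up to a factor 2 then have ratios between 16 / 4
    and 16 * 4. The 32 comes from half of the first level, 1 / 16. *)
Definition quantile_grid (S : R -> R) (b : nat -> R) (J : nat) : Prop :=
  [/\ 0 < b 0%N, 1 <= 32 * S (b 0%N), 0 < S (b J) &
      forall j, (j < J)%N -> 4 * S (b j.+1) <= S (b j) <= 64 * S (b j.+1)].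

(** * Hazard comparison and Chernoff exponent on a quantile grid *)

Section gain.
Variables (f S : R -> R) (b : nat -> R) (J : nat).
Hypotheses (K : mhr_tail f S) (Q : quantile_grid S b J).

Let f0 x : 0 <= f x. Proof. by case: K. Qed.
Let S0 x : 0 <= S x. Proof. by case: K => _ /(_ x)/andP[]. Qed.
Let Sm x y : x <= y -> S y <= S x. Proof. by case: K => _ _ /(_ x y). Qed.
Let fS x y : 0 <= x -> x <= y -> (y - x) * f y <= S x - S y <= (y - x) * f x.
Proof. by case: K => _ _ _ + _; apply. Qed.
Let hz x y : 0 <= x -> x <= y -> f x * S y <= f y * S x.
Proof. by case: K => _ _ _ _; apply. Qed.
Let b00 : 0 < b 0%N. Proof. by case: Q. Qed.
Let Sr j : (j < J)%N -> 4 * S (b j.+1) <= S (b j) <= 64 * S (b j.+1).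
Proof. by case: Q => _ _ _; apply. Qed.

Lemma grid_tail_gt0 j : (j <= J)%N -> 0 < S (b j).
Proof.
move=> jJ; case: Q => _ _ SJ _; rewrite -(subKn jJ).
elim: (J - j)%N => [|k IH]; first by rewrite subn0.
have [kJ|Jk] := ltnP k J; last by move: IH; rewrite (eqP Jk) (eqP (leqW Jk)).
have /Sr : (J - k.+1 < J)%N by rewrite ltn_subrL (leq_ltn_trans _ kJ).
rewrite subnSK// => /andP[+ _]; lra.
Qed.

Lemma grid_lt j : (j < J)%N -> b j < b j.+1.
Proof.
move=> jJ; rewrite ltNge; apply/negP => /Sm.
by move: (Sr jJ) (grid_tail_gt0 jJ) => /andP[]; lra.
Qed.

Lemma grid_le i j : (i <= j <= J)%N -> b i <= b j.
Proof. exact/incr_upto_le/grid_lt. Qed.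

Lemma grid_gt0 j : (j <= J)%N -> 0 < b j.
Proof. by move=> jJ; rewrite (lt_le_trans b00)// grid_le. Qed.

(* Unimodality alone: [f (b j.+1)] is at most the average of [f] over the gap. *)
Lemma grid_hazard_le j : (j < J)%N ->
  f (b j.+1) <= 63 * slope b j.+1 * S (b j.+1).
Proof.
move=> jJ; have g0 := grid_lt jJ.
have /andP[+ _] := fS (ltW (grid_gt0 (ltnW jJ))) (ltW g0).
have /andP[_ Sj] := Sr jJ.
move=> h; have {}h : f (b j.+1) <= (b j.+1 - b j)^-1 * (63 * S (b j.+1)).
  by rewrite ler_pdivlMl ?subr_gt0//; lra.
rewrite (le_trans h)// mulrC [leRHS]mulrAC; apply: ler_wpM2l.
  by rewrite mulr_ge0 ?S0 ?ler0n.
by rewrite /= le_max lexx orbT.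
Qed.

(** The gap carries at least 3/4 of [S (b j)], and by unimodality at most its length times
    [f (b j)]. The monotone hazard moves this bound from [b j] to [b j.+1]. *)
Lemma grid_gap_hazard j : (j < J)%N ->
  3 * (b j.+1 - b j)^-1 * S (b j.+1) <= 4 * f (b j.+1).
Proof.
move=> jJ; have g0 := grid_lt jJ.
have bj0 := ltW (grid_gt0 (ltnW jJ)).
have SJ := grid_tail_gt0 jJ; have Sj := grid_tail_gt0 (ltnW jJ).
have /andP[_ h1] := fS bj0 (ltW g0); have h2 := hz bj0 (ltW g0).
have /andP[h3 _] := Sr jJ.
rewrite mulrAC ler_pdivrMr ?subr_gt0//.
have h4 : (S (b j) - S (b j.+1)) * S (b j.+1) <=
    (b j.+1 - b j) * (f (b j.+1) * S (b j)).
  rewrite (le_trans (ler_wpM2r (ltW SJ) h1))// -mulrA ler_wpM2l// subr_ge0 ltW//.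
rewrite -(ler_pM2r Sj).
have : 3 * S (b j) * S (b j.+1) <= 4 * ((S (b j) - S (b j.+1)) * S (b j.+1)).
  by rewrite mulrA ler_wpM2r// ?(ltW SJ)//; lra.
lra.
Qed.

(** The maximum in [slope] is reached either at the last gap, treated by [grid_gap_hazard], or at an
    earlier one, and the hazard has only grown since. *)
Lemma grid_hazard_ge j : (j < J)%N ->
  3 * slope b j.+1 * S (b j.+1) <= 4 * f (b j.+1).
Proof.
elim: j => [|j IH] jJ; have h := grid_gap_hazard jJ.
  by rewrite /= max_r// invr_ge0 subr_ge0 ltW// grid_lt.
rewrite -[slope b j.+2]/(Num.max (slope b j.+1) (b j.+2 - b j.+1)^-1).
case: (leP (slope b j.+1) (b j.+2 - b j.+1)^-1) => // _.
have g0 := grid_lt jJ; have bj0 := ltW (grid_gt0 (ltnW jJ)).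
have h2 := hz bj0 (ltW g0).
rewrite -(ler_pM2r (grid_tail_gt0 (ltnW jJ))).
move: (ler_wpM2r (S0 (b j.+2)) (IH (ltnW jJ))); lra.
Qed.

Lemma grid_gap_ge r j : 0 <= r -> r * slope b J <= 1 -> (j < J)%N ->
  r <= b j.+1 - b j.
Proof.
move=> r0 rs jJ; have g0 := grid_lt jJ.
suff : r / (b j.+1 - b j) <= 1 by rewrite ler_pdivrMr ?subr_gt0// mul1r.
apply: le_trans rs; apply: ler_wpM2l => //.
apply: (@le_trans _ _ (slope b j.+1)); last exact: slope_homo.
by rewrite /= le_max lexx orbT.
Qed.

(* If [X] has tail [S], then [score (X - r)] has mean [- score_mean r] and
   second moment at most [score_var r] (on a grid, by [score_sqr_le]). *)
Definition score_mean (r : R) : R :=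
  \sum_(j < J) (slope b j.+1 - slope b j) * (S (b j.+1 - r) - S (b j.+1 + r)).

Definition score_var (r : R) : R :=
  \sum_(j < J) (slope b j.+1 ^+ 2 - slope b j ^+ 2) *
    (S (b j.+1 - r) + S (b j.+1 + r)).

(** Term by term: [S] drops by at least [r * f (b j.+1)] just below [b j.+1], and the hazard there
    is at least 3/4 of the slope. As [r] is at most a gap, the two tails add up to at most
    [128 * S (b j.+1)], whence 3/512. The factor 2 bounds [slope b j.+1 + slope b j] by
    [2 * slope b j.+1]. *)
Lemma score_mean_ge r : 0 < r -> r * slope b J <= 1 ->
  3 / 512 * r * score_var r <= 2 * score_mean r.
Proof.
move=> r0 rs; have c0 : 0 <= 3 / 512 :> R by rewrite divr_ge0 ?ler0n.
rewrite /score_var /score_mean !mulr_sumr; apply: ler_sum => j _.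
have jJ := ltn_ord j.
have ss := slope_le b j; have s0 := slope_ge0 b j.
have g0 := grid_lt jJ.
have rg := grid_gap_ge (ltW r0) rs jJ.
have bj0 := ltW (grid_gt0 (ltnW jJ)).
have h1 : S (b j.+1 - r) <= S (b j) by apply: Sm; lra.
have h2 : S (b j.+1 + r) <= S (b j.+1) by apply: Sm; lra.
have br0 : 0 <= b j.+1 - r by lra.
have br : b j.+1 - r <= b j.+1 by lra.
have /andP[h3 _] := fS br0 br.
have /andP[h4 h5] := Sr jJ.
have h6 : r * (3 * slope b j.+1 * S (b j.+1)) <= r * (4 * f (b j.+1)).
  by rewrite ler_pM2l// grid_hazard_ge.
have h7 : 3 / 512 * r * slope b j.+1 * (S (b j.+1 - r) + S (b j.+1 + r)) <=
    S (b j.+1 - r) - S (b j.+1 + r).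
  apply: (@le_trans _ _ (3 / 512 * r * slope b j.+1 * (128 * S (b j.+1)))); last lra.
  apply: ler_wpM2l; last lra.
  exact: mulr_ge0 (mulr_ge0 c0 (ltW r0)) (slope_ge0 _ _).
have SS : 0 <= S (b j.+1 - r) + S (b j.+1 + r) by rewrite addr_ge0.
apply: (@le_trans _ _ ((slope b j.+1 - slope b j) *
    (2 * (3 / 512 * r * slope b j.+1 * (S (b j.+1 - r) + S (b j.+1 + r))))));
  last first.
  rewrite mulrCA ler_pM2l//; apply: ler_wpM2l => //.
  by rewrite subr_ge0.
have -> : slope b j.+1 ^+ 2 - slope b j ^+ 2 =
    (slope b j.+1 - slope b j) * (slope b j.+1 + slope b j) by ring.
set a := slope b j.+1 - slope b j; set D := _ + S _.
have -> : 3 / 512 * r * (a * (slope b j.+1 + slope b j) * D) =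
   a * ((slope b j.+1 + slope b j) * (3 / 512 * r * D)) by ring.
have -> : a * (2 * (3 / 512 * r * slope b j.+1 * D)) =
   a * ((2 * slope b j.+1) * (3 / 512 * r * D)) by ring.
apply: ler_wpM2l; first by rewrite subr_ge0.
apply: ler_wpM2r; last lra.
exact: mulr_ge0 (mulr_ge0 c0 (ltW r0)) SS.
Qed.

(** Summation by parts: tails shrink at least by a factor 4, so each subtracted square costs at most
    a quarter of the preceding term. The boundary term carries the induction. *)
Lemma score_var_ge r : 0 < r ->
  3 / 4 * (\sum_(j < J) slope b j.+1 ^+ 2 * S (b j.+1)) +
  1 / 4 * (slope b J ^+ 2 * S (b J)) <= score_var r.
Proof.
move=> r0.
apply: (@le_trans _ _
    (\sum_(j < J) (slope b j.+1 ^+ 2 - slope b j ^+ 2) * S (b j.+1))); last first.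
  apply: ler_sum => j _; apply: ler_wpM2l.
    by rewrite subr_ge0 ler_sqr ?nnegrE ?slope_ge0// slope_le.
  by rewrite -[leLHS]addr0 lerD// Sm// gerBl ltW.
elim: J Sr => [|k IH] Sr'; first by rewrite !big_ord0 /= expr0n /= mulr0 mul0r mulr0 addr0.
rewrite !big_ord_recr/= -[Num.max _ _]/(slope b k.+1).
have {}IH := IH (fun j jk => Sr' j (ltnW jk)).
have /andP[h _] := Sr' _ (ltnSn k).
have : slope b k ^+ 2 * (4 * S (b k.+1)) <= slope b k ^+ 2 * S (b k).
  by apply: ler_wpM2l => //; rewrite sqr_ge0.
move: (slope b k ^+ 2) (slope b k.+1 ^+ 2) IH => s s' IH hs.
rewrite (le_trans _ (lerD IH (lexx _)))//.
by move: (S (b k)) (S (b k.+1)) (\sum_(_ < _) _) hs => x y z hs; lra.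
Qed.

(* The Chernoff exponent at the tilt [3 / 2048 * r], a quarter of the ratio
   [3 / 512 * r] of [score_mean_ge]. *)
Definition score_gain (r : R) : R :=
  3 / 2048 * r * score_mean r - (3 / 2048 * r) ^+ 2 * score_var r.

(** At this tilt [score_mean] is at least twice the tilt times [score_var], so the linear term pays
    for the quadratic one twice. *)
Lemma score_gain_ge r : 0 < r -> r * slope b J <= 1 ->
  (3 / 2048) ^+ 2 * r ^+ 2 * score_var r <= score_gain r.
Proof.
move=> r0 rs; rewrite /score_gain; have := score_mean_ge r0 rs.
have k0 : 0 <= 3 / 2048 * r by apply: mulr_ge0; [lra|exact: ltW].
move=> /(ler_wpM2l k0); lra.
Qed.

(** The sum on the left is the one that controls the Hellinger distance in [hellinger2_le]; the 63
    is that of [grid_hazard_le]. *)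
Lemma score_gain_small r : 0 < r -> r * slope b J <= 1 ->
  (3 / 2048) ^+ 2 * (3 / 4) * r ^+ 2 *
    (\sum_(j < J) f (b j.+1) ^+ 2 / S (b j.+1)) <=
  63 ^+ 2 * score_gain r.
Proof.
move=> r0 rs; have h1 := score_gain_ge r0 rs; have h2 := score_var_ge r0.
have h3 : \sum_(j < J) f (b j.+1) ^+ 2 / S (b j.+1) <=
  63 ^+ 2 * (\sum_(j < J) slope b j.+1 ^+ 2 * S (b j.+1)).
  rewrite mulr_sumr; apply: ler_sum => j _.
  have Sj := grid_tail_gt0 (ltn_ord j).
  rewrite ler_pdivrMr//.
  have -> : 63 ^+ 2 * (slope b j.+1 ^+ 2 * S (b j.+1)) * S (b j.+1) =
    (63 * slope b j.+1 * S (b j.+1)) ^+ 2 by ring.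
  by rewrite ler_sqr ?nnegrE// ?grid_hazard_le// !mulr_ge0// ?slope_ge0// S0.
have h4 : 0 <= slope b J ^+ 2 * S (b J) by rewrite mulr_ge0// sqr_ge0.
apply: le_trans (ler_wpM2l (sqr_ge0 63) h1).
have e : 0 <= (3 / 2048) ^+ 2 * r ^+ 2 := mulr_ge0 (sqr_ge0 _) (sqr_ge0 _).
set T := \sum_(_ < _) _ in h2 h3 *; set T' := \sum_(_ < _) _ in h3 *.
have -> : (3 / 2048) ^+ 2 * (3 / 4) * r ^+ 2 * T' =
  ((3 / 2048) ^+ 2 * r ^+ 2) * (3 / 4 * T') by ring.
have -> : 63 ^+ 2 * ((3 / 2048) ^+ 2 * r ^+ 2 * score_var r) =
  ((3 / 2048) ^+ 2 * r ^+ 2) * (63 ^+ 2 * score_var r) by ring.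
by apply: ler_wpM2l => //; lra.
Qed.

Lemma grid_slope_gt0 : (0 < J)%N -> 0 < slope b J.
Proof.
case: J grid_lt => // k gl _; rewrite /= lt_max invr_gt0 subr_gt0.
by rewrite gl ?orbT.
Qed.

(** At this shift [r ^+ 2 * slope b J ^+ 2] is 1, and the outermost term of [score_var_ge] alone
    gives the tail mass. *)
Lemma score_gain_large : (0 < J)%N ->
  (3 / 2048) ^+ 2 * S (b J) <= score_gain (slope b J)^-1.
Proof.
move=> J0; have s0 := grid_slope_gt0 J0; set r := (slope b J)^-1.
have r0 : 0 < r by rewrite invr_gt0.
have rs : r * slope b J <= 1 by rewrite mulVf// gt_eqF.
apply: le_trans (score_gain_ge r0 rs).
rewrite -mulrA; apply: ler_wpM2l; first by rewrite sqr_ge0.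
apply: (@le_trans _ _ (r ^+ 2 * (slope b J ^+ 2 * S (b J)))).
  by rewrite mulrA -exprMn mulVf ?gt_eqF// expr1n mul1r.
rewrite ler_pM2l ?exprn_gt0//; apply: le_trans (score_var_ge r0).
case: J J0 Sr => // k _ _; rewrite big_ord_recr/= -[Num.max _ _]/(slope b k.+1).
have : 0 <= \sum_(i < k) slope b i.+1 ^+ 2 * S (b i.+1).
  by apply: sumr_ge0 => i _; rewrite mulr_ge0// sqr_ge0.
set T := \sum_(_ < _) _; lra.
Qed.

End gain.
End score.

(** * I.i.d. samples *)

Section level_sets.
Context d {T : measurableType d} {R : realType}.
Variable Y : T -> R.
Hypothesis mY : measurable_fun [set: T] Y.

Lemma measurable_le_set (t : R) : measurable [set x | t <= Y x].
Proof.
rewrite (_ : [set _ | _] = Y @^-1` `[t, +oo[).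
  by rewrite -[X in measurable X]setTI; exact: mY.
by apply/seteqP; split => x /=; rewrite in_itv/= andbT.
Qed.

Lemma measurable_lt_set (t : R) : measurable [set x | t < Y x].
Proof.
rewrite (_ : [set _ | _] = Y @^-1` `]t, +oo[).
  by rewrite -[X in measurable X]setTI; exact: mY.
by apply/seteqP; split => x /=; rewrite in_itv/= andbT.
Qed.

Lemma measurable_ge_set (t : R) : measurable [set x | Y x <= t].
Proof.
rewrite (_ : [set _ | _] = Y @^-1` `]-oo, t]).
  by rewrite -[X in measurable X]setTI; exact: mY.
by apply/seteqP; split => x /=; rewrite in_itv/=.
Qed.

End level_sets.

Section iid_theory.
Context d {T : measurableType d} {R : realType}.
Variable P : probability T R.

Definition tcat k m (y : k.-tuple T) (z : m.-tuple T) : (k + m).-tuple T :=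
  [tuple of y ++ z].

Lemma measurable_tcat k m :
  measurable_fun [set: k.-tuple T * m.-tuple T] (fun w => tcat w.1 w.2).
Proof.
apply/measurable_fun_tnthP => i.
case: (split_ordP i) => j ->.
- rewrite (_ : _ \o _ = fun w : k.-tuple T * m.-tuple T => tnth w.1 j).
    by apply: (measurableT_comp (measurable_tnth j)); exact: measurable_fst.
  by apply/funext => w /=; rewrite tnth_lshift.
- rewrite (_ : _ \o _ = fun w : k.-tuple T * m.-tuple T => tnth w.2 j).
    by apply: (measurableT_comp (measurable_tnth j)); exact: measurable_snd.
  by apply/funext => w /=; rewrite tnth_rshift.
Qed.

Lemma iidS n (A : set (n.+1.-tuple T)) : measurable A ->
  iid P n.+1 A = (\int[P]_x iid P n [set y | A (tuple_cons (x, y))])%E.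
Proof.
move=> mA; rewrite /= /distribution /pushforward /product_measure1/=.
apply: eq_integral => x _; congr (iid P n _).
by apply/seteqP; split => y /=; rewrite /xsection/= ?inE.
Qed.

Lemma tcat_cons k m x (y : k.-tuple T) (z : m.-tuple T) :
  tcat (tuple_cons (x, y)) z = tuple_cons (x, tcat y z) :> (k.+1 + m).-tuple T.
Proof. exact: val_inj. Qed.

Lemma measurable_iid_tcat k m (A : set ((k + m).-tuple T)) : measurable A ->
  measurable_fun [set: m.-tuple T] (fun z => iid P k [set y | A (tcat y z)]).
Proof.
move=> mA; pose B := [set w : m.-tuple T * k.-tuple T | A (tcat w.2 w.1)].
have mB : measurable B.
  rewrite -[B]setTI.
  exact: (measurableT_comp (@measurable_tcat k m)
    (@measurable_swap _ _ (m.-tuple T) (k.-tuple T))).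
rewrite (_ : (fun z => _) = iid P k \o xsection B); last first.
  apply/funext => z /=; congr (iid P k _).
  by apply/seteqP; split => y /=; rewrite /xsection/= ?inE.
exact: measurable_fun_xsection.
Qed.

Lemma measurable_tcatl k m (z : m.-tuple T) :
  measurable_fun [set: k.-tuple T] (fun y => tcat y z).
Proof.
exact: (measurableT_comp (@measurable_tcat k m)
  (@pair2_measurable _ _ (k.-tuple T) (m.-tuple T) z)).
Qed.

(** Independence of the two blocks in Fubini form. The induction peels off the first coordinate, and
    Tonelli moves its integral inside the one over [z]. *)
Lemma iid_cat k m (A : set ((k + m).-tuple T)) : measurable A ->
  iid P (k + m) A = (\int[iid P m]_z iid P k [set y | A (tcat y z)])%E.
Proof.
elim: k A => [|k IH] A mA.
  rewrite (eq_integral (fun z : m.-tuple T => (\1_(A : set (m.-tuple T)) z)%:E)); last first.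
    move=> z _; rewrite /= diracE indicE; congr ((nat_of_bool _)%:R%:E).
    have e : tcat [tuple] z = z by exact: val_inj.
    by apply/idP/idP; rewrite !inE /= e.
  by rewrite integral_indic// setIT.
rewrite iidS//.
pose f (w : T * m.-tuple T) :=
  iid P k [set y | A (tcat (tuple_cons (w.1, y)) w.2)].
have mcons x : measurable [set w | A (tuple_cons (x, w))].
  rewrite -[X in measurable X]setTI.
  have mc : measurable_fun [set: (k + m).-tuple T] (fun w => tuple_cons (x, w)).
    by apply: measurableT_comp => //; exact: pair1_measurable.
  exact: mc.
under eq_integral => x _.
  rewrite IH; last exact: mcons.
  rewrite (_ : (fun z => _) = fun z => f (x, z)); last first.
    by apply/funext => z; congr (iid P k _); apply/funext => y /=; rewrite tcat_cons.
  over.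
have mf : measurable_fun setT f.
  pose B := [set w : (T * m.-tuple T) * k.-tuple T |
    A (tcat (tuple_cons (w.1.1, w.2)) w.1.2)].
  have mB : measurable B.
    rewrite -[B]setTI.
    have h : measurable_fun [set: (T * m.-tuple T) * k.-tuple T]
        (fun w => (tuple_cons (w.1.1, w.2), w.1.2)).
      apply: measurable_fun_pair.
        apply: measurableT_comp => //; apply: measurable_fun_pair => //.
        exact: measurableT_comp measurable_fst measurable_fst.
      exact: measurableT_comp measurable_snd measurable_fst.
    exact: (measurableT_comp (@measurable_tcat k.+1 m) h).
  rewrite (_ : f = iid P k \o xsection B); last first.
    apply/funext => z /=; congr (iid P k _).
    by apply/seteqP; split => y /=; rewrite /xsection/= ?inE.
  exact: measurable_fun_xsection.
rewrite fubini_tonelli//.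
apply: eq_integral => z _; rewrite iidS//.
rewrite -[X in measurable X]setTI.
exact: (@measurable_tcatl k.+1 m z).
Qed.

(** Sample splitting: [z] is the pilot half. A bad pilot costs [e1], and for a good one the bound
    [e2] is proved with [z] frozen. *)
Lemma iid_cat_le k m (A : set ((k + m).-tuple T)) (G : set (m.-tuple T))
    (e1 e2 : R) : measurable A -> measurable G -> 0 <= e2 ->
  (iid P m (~` G) <= e1%:E)%E ->
  (forall z, G z -> iid P k [set y | A (tcat y z)] <= e2%:E)%E ->
  (iid P (k + m) A <= (e1 + e2)%:E)%E.
Proof.
move=> mA mG e20 h1 h2; rewrite iid_cat//.
apply: (@le_trans _ _ (\int[iid P m]_z ((\1_(~` G) z)%:E + e2%:E))%E).
  apply: ge0_le_integral => //.
  - exact: measurable_iid_tcat.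
  - apply: emeasurable_funD => //; apply/measurable_EFinP.
    by apply: measurable_indic; exact: measurableC.
  - move=> z _; rewrite indicE; have [Gz|Gz] := pselect (G z).
      by rewrite memNset ?add0e ?h2//=; apply.
    rewrite mem_set//; apply: le_trans (probability_le1 _ _) _.
      rewrite -[X in measurable X]setTI.
      exact: measurable_tcatl.
    by rewrite -EFinD lee_fin lerDl.
rewrite ge0_integralD//; last first.
  by apply/measurable_EFinP; apply: measurable_indic; exact: measurableC.
rewrite integral_indic ?setIT//; last exact: measurableC.
rewrite integral_cst// EFinD; apply: leeD => //; rewrite -[leRHS]mule1.
by apply: lee_pmul => //; exact: probability_le1.
Qed.

Lemma integral_iidS n (F : n.+1.-tuple T -> \bar R) :
  measurable_fun setT F -> (forall y, 0 <= F y)%E ->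
  (\int[iid P n.+1]_y F y = \int[P]_x \int[iid P n]_y F (tuple_cons (x, y)))%E.
Proof.
move=> mF F0.
transitivity (\int[(P \x iid P n)%E]_w (F \o @tuple_cons _ _ n) w)%E.
  exact: (@ge0_integral_distribution _ _ _ _ R (P \x iid P n)%E (@tuple_cons _ _ n) F).
rewrite (fubini_tonelli1 (F \o @tuple_cons _ _ n))//; last by move=> w; exact: F0.
exact: (measurableT_comp mF).
Qed.

Lemma iid_mgf_le n (phi : T -> R) (c : R) : measurable_fun setT phi ->
  (\int[P]_x (expR (phi x))%:E <= c%:E)%E ->
  (\int[iid P n]_y (expR (\sum_(i < n) phi (tnth y i)))%:E <= (c ^+ n)%:E)%E.
Proof.
move=> mphi hc.
have mexp : measurable_fun setT (fun x => (expR (phi x))%:E).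
  by apply/measurable_EFinP; exact: measurableT_comp.
have mS k : measurable_fun [set: k.-tuple T]
    (fun y => (expR (\sum_(i < k) phi (tnth y i)))%:E).
  apply/measurable_EFinP; apply: measurableT_comp => //.
  by apply: measurable_sum => i; exact: measurableT_comp (measurable_tnth i).
have c0 : 0 <= c.
  by rewrite -lee_fin (le_trans _ hc)// integral_ge0// => x _; rewrite lee_fin expR_ge0.
elim: n => [|n IH].
  rewrite /= integral_dirac ?diracT ?mul1e ?big_ord0 ?expR0 ?expr0//.
  exact: (mS 0).
have -> := integral_iidS (mS n.+1) (fun y => expR_ge0 _).
set I := (\int[iid P n]_y _)%E in IH.
have I0 : (0 <= I)%E by apply: integral_ge0 => y _; rewrite lee_fin expR_ge0.
have E x : (\int[iid P n]_y (expR (\sum_(i < n.+1) phi (tnth (tuple_cons (x, y)) i)))%:E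
    = (expR (phi x))%:E * I)%E.
  rewrite -ge0_integralZl ?lee_fin ?expR_ge0//; last exact: (mS n).
  apply: eq_integral => y _; rewrite big_ord_recl tnth0/= expRD EFinM.
  by under eq_bigr do rewrite tnthS.
under eq_integral do rewrite E.
rewrite ge0_integralZr//.
rewrite exprS EFinM; apply: lee_pmul => //.
by apply: integral_ge0 => x _; rewrite lee_fin expR_ge0.
Qed.

Lemma measurable_sum_ge0 n (phi : T -> R) : measurable_fun setT phi ->
  measurable [set y : n.-tuple T | (0 <= \sum_(i < n) phi (tnth y i))%R].
Proof.
move=> mphi; apply: measurable_le_set.
by apply: measurable_sum => i; exact: measurableT_comp (measurable_tnth i).
Qed.

(** Markov's inequality for the exponential of the sum; the tilt is already part of [phi]. *)
Lemma iid_chernoff n (phi : T -> R) (c : R) : measurable_fun setT phi ->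
  (\int[P]_x (expR (phi x))%:E <= c%:E)%E ->
  (iid P n [set y | (0 <= \sum_(i < n) phi (tnth y i))%R] <= (c ^+ n)%:E)%E.
Proof.
move=> mphi hc; apply: le_trans (iid_mgf_le n mphi hc).
have mS : measurable_fun [set: n.-tuple T] (fun y => \sum_(i < n) phi (tnth y i)).
  by apply: measurable_sum => i; exact: measurableT_comp (measurable_tnth i).
set A := [set y | _].
have mA : measurable A by exact: measurable_sum_ge0.
rewrite -[A]setIT -integral_indic//; apply: ge0_le_integral => //.
- by apply/measurable_EFinP; exact: measurable_indic.
- by apply/measurable_EFinP; exact: measurableT_comp.
- move=> y _; rewrite lee_fin indicE; have [Ay|Ay] := pselect (A y).
    by rewrite mem_set//= -expR0 ler_expR.
  by rewrite memNset//= expR_ge0.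
Qed.

End iid_theory.

(** * Sign changes of monotone functions *)

Section crossing.
Context {R : realType}.

(** A step function may jump over 0, so its root is taken as the end of the region of positivity.
    [fine] gives the default 0 when there is no sign change and the supremum is infinite. *)
Definition crossing (F : R -> R) : R :=
  fine (ereal_sup [set x%:E | x in [set x | 0 < F x]]).

Lemma crossing_itv (F : R -> R) x y : (forall u v, u <= v -> F v <= F u) ->
  0 < F x -> F y <= 0 -> x <= crossing F <= y.
Proof.
move=> Fm Fx Fy; rewrite /crossing; set s := ereal_sup _.
have xs : (x%:E <= s)%E by apply: ereal_sup_ubound; exists x.
have sy : (s <= y%:E)%E.
  apply: ge_ereal_sup => _ [u /= Fu <-]; rewrite lee_fin leNgt.
  by apply/negP => /ltW/Fm; rewrite leNgt (le_lt_trans Fy).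
have sf : s \is a fin_num.
  rewrite fin_numE; apply/andP; split.
    by rewrite -ltNye (lt_le_trans (ltNyr x)).
  by rewrite -ltey (le_lt_trans sy) ?ltry.
by rewrite -!lee_fin fineK// xs.
Qed.

Lemma measurable_crossing d (T : measurableType d) (F : T -> R -> R) :
  (forall w u v, u <= v -> F w v <= F w u) ->
  (forall u, measurable_fun [set: T] (F ^~ u)) ->
  measurable_fun [set: T] (fun w => crossing (F w)).
Proof.
move=> Fm mF; rewrite /crossing.
apply: measurableT_comp => // mD.
apply: (measurability _ (ErealGenOInfty.measurableE R)) => //.
move=> _ [_ [x ->] <-]; rewrite setTI.
(* By monotonicity, positivity at some [u > x] persists at a rational between [x] and [u], so a
   countable union suffices. *)
rewrite (_ : _ @^-1` _ = \bigcup_(q : rat)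
    (if x < ratr q then [set w | 0 < F w (ratr q)] else set0)).
  apply: bigcupT_measurable_rat => q; case: ifPn => // _.
  rewrite (_ : [set w | _] = (F ^~ (ratr q)) @^-1` `]0, +oo[).
    by rewrite -[X in measurable X]setTI; exact: mF.
  by apply/seteqP; split => w /=; rewrite in_itv/= andbT.
apply/seteqP; split => w /=.
  rewrite in_itv/= andbT => /ereal_sup_gt[_ [u /= Fu <-]]; rewrite lte_fin => xu.
  have [q] := rat_in_itvoo xu; rewrite in_itv/= => /andP[xq qu].
  by exists q => //; rewrite xq/=; apply: lt_le_trans Fu (Fm _ _ _ (ltW qu)).
move=> [q _]; case: ifPn => // xq /= Fq.
rewrite in_itv/= andbT; apply: (@lt_le_trans _ _ (ratr q)%:E); rewrite ?lte_fin//.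
by apply: ereal_sup_ubound; exists (ratr q).
Qed.

End crossing.

(** * Tails of symmetric unimodal densities *)

Section reflection.
Context {R : realType}.
Variable c : R.

Let refl : measurableTypeR R -> measurableTypeR R := fun x => c - x.

Let measurable_refl : measurable_fun [set: measurableTypeR R] refl.
Proof. by apply: measurable_funB; [exact: measurable_cst|exact: measurable_id]. Qed.

HB.instance Definition _ :=
  @isMeasurableFun.Build _ _ _ _ refl measurable_refl.

Lemma pushforward_reflection (A : set (measurableTypeR R)) : measurable A ->
  pushforward (@lebesgue_measure R)
    (fun x : measurableTypeR R => c - x : measurableTypeR R) A = lebesgue_measure A.
Proof.
move=> mA; apply/esym.
apply: (@lebesgue_measure_unique _ (pushforward (@lebesgue_measure R) refl)) => //=.
move=> _ [[a b]] _ <-.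
rewrite /pushforward.
have -> : refl @^-1` `]a, b]%classic = [set` `[(c - b), (c - a)[].
  by apply/seteqP; split=> x /=; rewrite /refl !in_itv/=; lra.
rewrite !lebesgue_measure_itv/= !lte_fin ltrD2l ltrN2; case: ifPn => // _.
by congr EFin; ring.
Qed.

Lemma ge0_integral_reflection (A : set R) (g : R -> \bar R) :
  measurable A -> measurable_fun [set: R] g -> (forall x, 0 <= g x)%E ->
  (\int[lebesgue_measure]_(x in [set x : R | A (c - x)%R]) g (c - x)%R
   = \int[lebesgue_measure]_(x in A) g x)%E.
Proof.
move=> mA mg g0.
have := @ge0_integral_pushforward _ _ _ _ R refl measurable_refl
  (@lebesgue_measure R) A g mA (measurable_funTS mg) (fun y _ => g0 y).
move=> h; rewrite -[LHS]h; apply: eq_measure_integral => B mB _.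
exact: pushforward_reflection.
Qed.

End reflection.

Section tail.
Context {R : realType}.
Implicit Types (f : density R) (x y r mu : R).

Definition tail f x : R := fine (density_law f `[x, +oo[).

Lemma tailE f x : density_law f `[x, +oo[ = (tail f x)%:E.
Proof. by rewrite /tail fineK// fin_num_measure. Qed.

Lemma measurable_EFin_pdf f : measurable_fun [set: R] (EFin \o f).
Proof. by apply/measurable_EFinP; exact: measurable_pdf. Qed.

Lemma tail_ge0 f x : 0 <= tail f x.
Proof. by rewrite -lee_fin -tailE measure_ge0. Qed.

Lemma tail_le1 f x : tail f x <= 1.
Proof. by rewrite -lee_fin -tailE probability_le1. Qed.

Lemma tail_nincr f x y : x <= y -> tail f y <= tail f x.
Proof.
move=> xy; rewrite -lee_fin -!tailE; apply: le_measure; rewrite ?inE//.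
by move=> z /=; rewrite !in_itv/= !andbT; exact: le_trans.
Qed.

Lemma tailB f x y : x <= y ->
  (tail f x - tail f y)%:E = density_law f `[x, y[.
Proof.
move=> xy; rewrite EFinB -!tailE.
have -> : `[x, +oo[%classic = `[x, y[%classic `|` `[y, +oo[%classic :> set R.
  apply/seteqP; split => z /=; rewrite !in_itv/= ?andbT.
    by move=> ->; case: (ltP z y) => zy; [left|right].
  by case=> [/andP[]//|]; exact: le_trans.
rewrite measureU//; last first.
  apply/seteqP; split => // z /= []; rewrite !in_itv/= andbT => /andP[_].
  by rewrite ltNge => /negbTE->.
by rewrite addeK// fin_num_measure.
Qed.

Section symmetric.
Variable f : density R.
Hypothesis fN : forall x, f x = f (- x).

Lemma density_law_reflection mu (A : set R) : measurable A ->
  density_law (translate mu f) [set x | A (mu - x)] = density_law f A.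
Proof.
move=> mA; rewrite /density_law.
rewrite -(ge0_integral_reflection mu mA (@measurable_EFin_pdf f)); last first.
  by move=> x /=; rewrite lee_fin pdf_ge0.
by apply: eq_integral => x _ /=; rewrite [in RHS]fN opprB.
Qed.

Lemma density_law_le mu x :
  density_law (translate mu f) `]-oo, x] = (tail f (mu - x))%:E.
Proof.
rewrite -tailE -(density_law_reflection mu)//; congr (density_law _ _).
by apply/seteqP; split => z /=; rewrite !in_itv/= ?andbT; lra.
Qed.

Lemma translate0 : translate 0 f = f :> (R -> R).
Proof. by apply/funext => x /=; rewrite subr0. Qed.

Lemma density_law_ge mu x :
  density_law (translate mu f) `[x, +oo[ = (tail f (x - mu))%:E.
Proof.
have -> : `[x, +oo[%classic = [set y | `]-oo, mu - x]%classic (mu - y)] :> set R.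
  by apply/seteqP; split => z /=; rewrite !in_itv/= ?andbT; lra.
rewrite density_law_reflection//.
have := density_law_le 0 (mu - x); rewrite sub0r opprB => <-.
by rewrite /density_law translate0.
Qed.

Lemma tail0_ge : 1 <= 2 * tail f 0.
Proof.
have h := density_law_le 0 0.
rewrite subr0 in h.
rewrite -lee_fin mulr_natl mulr2n EFinD -{1}h -tailE.
rewrite {1}/density_law translate0 -/(density_law f _).
rewrite -(@probability_setT _ _ _ (density_law f)).
have -> : [set: R] = `]-oo, 0%R]%classic `|` `[0%R, +oo[%classic :> set R.
  apply/seteqP; split => z //= _; rewrite !in_itv/= andbT.
  by case: (leP z 0); [left|right; exact: ltW].
exact: measureU2.
Qed.

Section unimodal.
Hypothesis f_nincr : forall x y, 0 <= x -> x <= y -> f y <= f x.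

Lemma tailB_itv x y : 0 <= x -> x <= y ->
  (y - x) * f y <= tail f x - tail f y <= (y - x) * f x.
Proof.
move=> x0 xy; rewrite -!lee_fin tailB// /density_law.
have m : lebesgue_measure `[x, y[%classic = (y - x)%:E.
  rewrite lebesgue_measure_itv/= lte_fin; case: ltP => // yx.
  by rewrite (@le_anti _ _ x y) ?xy// subrr.
have c k : (((y - x) * k)%:E = \int[lebesgue_measure]_(z in `[x, y[) (cst k%:E z))%E.
  by rewrite integral_cst//=; rewrite [X in (_ * X)%E](_ : _ = (y - x)%:E)// -EFinM mulrC.
apply/andP; split; rewrite c; apply: ge0_le_integral => //=.
- by move=> z _; rewrite lee_fin pdf_ge0.
- by apply: measurable_funTS; exact: measurable_EFin_pdf.
- by move=> z; rewrite in_itv/= => /andP[xz zy]; rewrite lee_fin f_nincr ?(le_trans x0 xz)// ltW.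
- by move=> z _; rewrite lee_fin pdf_ge0.
- by apply: measurable_funTS; exact: measurable_EFin_pdf.
- by move=> z; rewrite in_itv/= => /andP[xz zy]; rewrite lee_fin f_nincr.
Qed.

End unimodal.
End symmetric.

(** The common ground of the two classes. The cross-multiplied hazard inequality also makes sense
    beyond the support, where the tail vanishes. *)
Definition sym_mhr f :=
  [/\ forall x, f x = f (- x), forall x y, 0 <= x -> x <= y -> f y <= f x &
      forall x y, 0 <= x -> x <= y -> f x * tail f y <= f y * tail f x].

Lemma sym_mhr_tail f : sym_mhr f -> mhr_tail f (tail f).
Proof.
move=> [fN fm fh]; split => //.
- exact: pdf_ge0.
- by move=> x; rewrite tail_ge0 tail_le1.
- exact: tail_nincr.
- exact: tailB_itv.
Qed.

Lemma sym_mhr_pdf0_gt0 f : sym_mhr f -> 0 < f 0.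
Proof.
move=> [fN fm _]; rewrite lt_neqAle pdf_ge0 andbT; apply/eqP => f0.
have := tail0_ge fN; rewrite /tail /density_law integral0_eq; last first.
  move=> x /=; rewrite in_itv/= andbT => x0; congr EFin.
  by apply/eqP; rewrite eq_le pdf_ge0 andbT f0 fm.
by rewrite /= mulr0 ler10.
Qed.

Lemma sym_mhr_tail_small f p : sym_mhr f -> 0 < p ->
  exists2 x, 0 <= x & tail f x <= p.
Proof.
move=> K p0; have f0 := sym_mhr_pdf0_gt0 K; case: (K) => fN fm fh.
(* [f 0 * tail f x <= f x] by the monotone hazard, and [x * f x <= 1]. *)
exists (f 0 * p)^-1; first by rewrite invr_ge0 mulr_ge0 ?ltW.
set x := _^-1; have x0 : 0 <= x by rewrite invr_ge0 mulr_ge0 ?ltW.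
have /andP[h _] := tailB_itv fm (lexx 0) x0.
have h2 := fh _ _ (lexx 0) x0.
rewrite subr0 in h.
have h3 : x * (f 0 * tail f x) <= 1.
  apply: (@le_trans _ _ (x * (f x * 1))).
    apply: ler_wpM2l => //; apply: le_trans h2 _.
    by apply: ler_wpM2l; rewrite ?pdf_ge0 ?tail_le1.
  rewrite mulr1 (le_trans h)// lerBlDr (le_trans (tail_le1 _ _))//.
  by rewrite lerDl tail_ge0.
move: h3; rewrite /x ler_pdivrMl ?mulr_gt0// mulr1.
by rewrite ler_pM2l.
Qed.

Lemma tail_quantile f p : sym_mhr f -> 0 < p -> 2 * p <= 1 ->
  exists2 x, 0 <= x & tail f x = p.
Proof.
move=> K p0 p1; have [X X0 fX] := sym_mhr_tail_small K p0.
case: (K) => fN fm fh.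
(* Freezing the tail to the left of 0 makes [g] Lipschitz with constant [f 0] on the whole line,
   ready for the intermediate value theorem. *)
pose g x := tail f (Num.max 0 x).
have gm x y : x <= y -> g x - g y <= (y - x) * f 0.
  move=> xy; rewrite /g.
  have m0 : 0 <= Num.max 0 x by rewrite le_max lexx.
  have mm : Num.max 0 x <= Num.max 0 y by rewrite ge_max !le_max lexx xy orbT.
  have /andP[_ h] := tailB_itv fm m0 mm.
  apply: (le_trans h); apply: ler_pM; rewrite ?subr_ge0 ?pdf_ge0 ?fm//.
  by case: (leP 0 x) => x0; case: (leP 0 y) => y0; lra.
have gn x y : x <= y -> g y <= g x.
  by move=> xy; apply: tail_nincr; rewrite ge_max !le_max lexx xy orbT.
have gc : continuous g.
  move=> x; apply/cvgrPdist_lt => e e0.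
  have f01 : 0 < f 0 + 1 by rewrite ltr_wpDl// pdf_ge0.
  near=> y.
  have d : `|x - y| < e / (f 0 + 1).
    by near: y; apply: cvgr_dist_lt => //; rewrite divr_gt0//.
  move: d; rewrite ltr_pdivlMr// => d.
  apply: le_lt_trans d; rewrite mulrDr mulr1.
  have := pdf_ge0 f 0; move: (f 0) gm => c gm c0.
  case: (leP x y) => xy.
    have := gm _ _ xy; have := gn _ _ xy; move=> h1 h2.
    rewrite ger0_norm ?subr_ge0// ler0_norm ?subr_le0// opprB; lra.
  have := gm _ _ (ltW xy); have := gn _ _ (ltW xy); move=> h1 h2.
  rewrite ler0_norm ?subr_le0// opprB ger0_norm ?subr_ge0// ?ltW//; lra.
have g0 : g 0 = tail f 0 by rewrite /g maxxx.
have gX : g X = tail f X by rewrite /g max_r.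
have [|x x01 gx] := @IVT R g 0 X p X0 (continuous_subspaceT gc).
  rewrite g0 gX; rewrite max_l ?min_r ?tail_nincr// fX/=.
  by have := tail0_ge fN; lra.
exists x; first by move: x01; rewrite in_itv/= => /andP[].
by rewrite -gx /g max_r//; move: x01; rewrite in_itv/= => /andP[].
Unshelve. all: by end_near. Qed.

End tail.

(** * Monotone hazard rates *)

Section classes_theory.
Context {R : realType}.
Implicit Types (f : density R) (x y z t : R).

Lemma econcave_lne f x y t : econcave (fun x => lne (f x)%:E) ->
  0 < f x -> 0 < f y -> 0 <= t <= 1 ->
  0 < f (t * x + (1 - t) * y) /\
  t * ln (f x) + (1 - t) * ln (f y) <= ln (f (t * x + (1 - t) * y)).
Proof.
move=> fc fx fy t01; have : (t%:E * lne (f x)%:E + (1 - t)%:E * lne (f y)%:E <=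
  lne (f (t * x + (1 - t) * y)%R)%:E)%E := fc x y t t01.
rewrite (lne_EFin fx) (lne_EFin fy) -!EFinM -EFinD.
case: (ltP 0 (f (t * x + (1 - t) * y))) => [f0|f0].
  by rewrite lne_EFin// lee_fin.
by rewrite le0_lneNy ?lee_fin// leeNy_eq.
Qed.

Lemma SLC_sym_mhr f : SLC f -> sym_mhr f.
Proof.
move=> [fN fc].
have fm x y : 0 <= x -> x <= y -> f y <= f x.
  move=> x0 xy; have [->|y0] := eqVneq y x; first by [].
  have {}y0 : 0 < y by rewrite (le_lt_trans x0)// lt_neqAle eq_sym y0.
  have := pdf_ge0 f y; rewrite le_eqVlt => /orP[/eqP<-|fy]; first exact: pdf_ge0.
  have fNy : 0 < f (- y) by rewrite -fN.
  (* This is the weight that writes [x] as a convex combination of [y] and [- y], where [f] takes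
     the same value. *)
  have t01 : 0 <= (x + y) / (2 * y) <= 1.
    rewrite divr_ge0 ?addr_ge0 ?mulr_ge0 ?(ltW y0)//= ler_pdivrMr ?mulr_gt0//; lra.
  have [] := econcave_lne fc fy fNy t01.
  have -> : (x + y) / (2 * y) * y + (1 - (x + y) / (2 * y)) * - y = x.
    by field; rewrite gt_eqF.
  rewrite -fN -mulrDl addrC subrK mul1r => fx.
  by rewrite ler_ln.
split => // x y x0 xy.
(* [y] and [x + z] are opposite convex combinations of [x] and [y + z]. *)
have pw z : 0 <= z -> f x * f (y + z) <= f y * f (x + z).
  move=> z0; have := pdf_ge0 f x; rewrite le_eqVlt => /orP[/eqP<-|fx].
    by rewrite mul0r mulr_ge0 ?pdf_ge0.
  have := pdf_ge0 f (y + z); rewrite le_eqVlt => /orP[/eqP<-|fyz].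
    by rewrite mulr0 mulr_ge0 ?pdf_ge0.
  have [<-|yx] := eqVneq x y; first by [].
  have {}yx : x < y by rewrite lt_neqAle yx.
  have D0 : 0 < y + z - x by lra.
  have t01 : 0 <= z / (y + z - x) <= 1.
    by rewrite divr_ge0 ?(ltW D0)//= ler_pdivrMr//; lra.
  have s01 : 0 <= (y - x) / (y + z - x) <= 1.
    by rewrite divr_ge0 ?(ltW D0) ?subr_ge0//= ler_pdivrMr//; lra.
  have [] := econcave_lne fc fx fyz t01.
  have [] := econcave_lne fc fx fyz s01.
  have -> : z / (y + z - x) * x + (1 - z / (y + z - x)) * (y + z) = y.
    by field; rewrite gt_eqF.
  have -> : (y - x) / (y + z - x) * x + (1 - (y - x) / (y + z - x)) * (y + z) = x + z.
    by field; rewrite gt_eqF.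
  move=> fxz h1 fy h2.
  rewrite -ler_ln ?posrE ?mulr_gt0// !lnM ?posrE//.
  have -> : ln (f x) + ln (f (y + z)) =
      z / (y + z - x) * ln (f x) + (1 - z / (y + z - x)) * ln (f (y + z)) +
      ((y - x) / (y + z - x) * ln (f x) + (1 - (y - x) / (y + z - x)) * ln (f (y + z))).
    by field; rewrite gt_eqF.
  exact: lerD.
(* It remains to integrate [pw] over [z]. For a common domain, [tail f x] is read as the mass of a
   translate of [f] on [[y, +oo[]. *)
rewrite -lee_fin !EFinM -tailE.
have -> : tail f x = tail f (y - (y - x)) by congr (tail f _); ring.
rewrite -(density_law_ge fN (y - x) y) /density_law.
have mf g : measurable_fun `[y, +oo[ (EFin \o pdf g).
  by apply: measurable_funTS; exact: measurable_EFin_pdf.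
rewrite -!ge0_integralZl ?lee_fin ?pdf_ge0//; last 4 first.
- exact: (mf (translate (y - x) f)).
- by move=> z _; rewrite lee_fin pdf_ge0.
- exact: (mf f).
- by move=> z _; rewrite lee_fin pdf_ge0.
apply: ge0_le_integral => //=.
- by move=> z _; rewrite -EFinM lee_fin mulr_ge0// pdf_ge0.
- by apply: measurable_funeM; exact: (mf f).
- by apply: measurable_funeM; exact: (mf (translate (y - x) f)).
- move=> z; rewrite in_itv/= andbT => yz; rewrite -!EFinM lee_fin.
  have := pw (z - y); rewrite subr_ge0 => /(_ yz).
  by congr (_ * f _ <= _ * f _); ring.
Qed.

Lemma tail_cdf f x : (forall x, f x = f (- x)) -> tail f x = 1 - density_cdf f x.
Proof.
move=> fN; rewrite /density_cdf.
have /(congr1 fine)/= <- := tailE f x.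
apply/eqP; rewrite eq_sym subr_eq; apply/eqP.
rewrite -fineD ?fin_num_measure//.
have -> : density_law f `]-oo, x] = density_law f `]-oo, x[.
  rewrite /density_law integral_itv_bndo_bndc//.
  by apply: measurable_funTS; exact: measurable_EFin_pdf.
rewrite addeC -measureU//; last first.
  apply/seteqP; split => // z /= []; rewrite !in_itv/= andbT ltNge.
  by move=> /negbTE->.
rewrite (_ : _ `|` _ = [set: R]); first exact/esym/(congr1 fine (integral_pdf f)).
apply/seteqP; split => z //= _; rewrite !in_itv/= andbT.
by case: (ltP z x); [left|right].
Qed.

(** If [f] is positive somewhere beyond [y], then [[0, y]] lies in the interior of the support with
    positive tails, and the hazard condition can be cross-multiplied. Otherwise [tail f y] is 0. *)
Lemma SUMHR_sym_mhr f : SUMHR f -> sym_mhr f.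
Proof.
move=> [fN fm fh]; split => // x y x0 xy.
have pos z w : 0 < f z -> `|w| <= z -> 0 < f w.
  move=> fz wz; apply: lt_le_trans fz _.
  have [w0|w0] := leP 0 w; first by apply: fm => //; exact: le_trans (ler_norm _) wz.
  by rewrite [f w]fN; apply: fm; [rewrite oppr_ge0 ltW|rewrite -(ltr0_norm w0)].
have [[z yz fz]|nz] := pselect (exists2 z, y < z & 0 < f z); last first.
  rewrite [tail f y](_ : _ = 0); last first.
    rewrite /tail /density_law -integral_itv_obnd_cbnd; last first.
      by apply: measurable_funTS; exact: measurable_EFin_pdf.
    rewrite integral0_eq// => z /=; rewrite in_itv/= andbT => yz.
    congr EFin; apply/eqP; rewrite eq_le pdf_ge0 andbT leNgt; apply/negP => fz.
    by apply: nz; exists z.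
  by rewrite mulr0 mulr_ge0 ?pdf_ge0 ?tail_ge0.
have int w : 0 <= w -> w <= y -> [set x : R | 0 < f x]° w.
  move=> w0 wy; exists (z - w) => /=; first by rewrite subr_gt0 (le_lt_trans wy).
  move=> v /= wv; apply: (pos z) => //.
  have := ler_normB w (w - v); rewrite opprB addrCA subrr addr0 => h.
  apply: (le_trans h); rewrite (ger0_norm w0) -lerBrDl; exact: ltW.
have tpos w : 0 <= w -> w <= y -> 0 < tail f w.
  move=> w0 wy; have wz : w <= z by rewrite (le_trans wy)// ltW.
  have /andP[h _] := tailB_itv fm w0 wz.
  have := tail_ge0 f z; have : 0 < (z - w) * f z by rewrite mulr_gt0// subr_gt0 (le_lt_trans wy).
  by move: h; lra.
have y0 := le_trans x0 xy.
have := fh _ _ (int _ x0 xy) (int _ y0 (lexx y)) xy.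
rewrite /hazard -!tail_cdf//.
by rewrite ler_pdivrMr ?tpos// mulrAC ler_pdivlMr ?tpos.
Qed.

End classes_theory.

(** * Hellinger distance between a density and its reflection *)

Section hellinger_bound.
Context {R : realType}.
Implicit Types (f : density R) (x y z t r : R).

Lemma measurable_sqrt_pdf f : measurable_fun [set: R] (fun x => Num.sqrt (f x)).
Proof.
apply: (@measurableT_comp _ _ _ _ _ _ (@Num.sqrt R) _ f) => //; last exact: measurable_pdf.
by apply: continuous_measurable_fun; exact: sqrt_continuous.
Qed.

(** Reflection about [r] exchanges the two densities, so both sides of [r] contribute equally and
    the factor 1/2 disappears. *)
Lemma hellinger2_half f r : (forall x, f x = f (- x)) ->
  (hellinger2 (translate 0 f) (translate (2 * r) f) <=
   \int[lebesgue_measure]_(x in `[r, +oo[)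
     ((Num.sqrt (f (x - 2 * r)) - Num.sqrt (f x)) ^+ 2)%:E)%E.
Proof.
move=> fN; rewrite /hellinger2.
set w := fun x => ((Num.sqrt (translate 0 f x) - Num.sqrt (translate (2 * r) f x)) ^+ 2)%:E.
set v := fun x => ((Num.sqrt (f (x - 2 * r)) - Num.sqrt (f x)) ^+ 2)%:E.
have w0 x : (0 <= w x)%E by rewrite lee_fin sqr_ge0.
have wv : w = v.
  by apply/funext => x; rewrite /w /v/= subr0 -sqrrN opprB.
have mw : measurable_fun [set: R] w.
  apply/measurable_EFinP; apply: measurable_funX.
  exact: (measurable_funB (measurable_sqrt_pdf (translate 0 f))
    (measurable_sqrt_pdf (translate (2 * r) f))).
have -> : [set: R] = `]-oo, r[%classic `|` `[r, +oo[%classic :> set R.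
  by apply/seteqP; split => z //= _; rewrite !in_itv/= andbT; case: (ltP z r); [left|right].
rewrite ge0_integral_setU//; last 3 first.
- by apply: measurable_funTS.
- by move=> x _; exact: w0.
- apply/disj_setPS => z /= []; rewrite !in_itv/= andbT ltNge.
  by move=> /negbTE->.
have h : (\int[lebesgue_measure]_(x in `]-oo, r[) w x <=
          \int[lebesgue_measure]_(x in `[r, +oo[) v x)%E.
  rewrite integral_itv_bndo_bndc; last exact: measurable_funTS.
  rewrite -wv -(@ge0_integral_reflection _ (2 * r) `[r, +oo[%classic w)//.
  have -> : [set x : R | `[r, +oo[%classic (2 * r - x)] = `]-oo, r]%classic.
    by apply/seteqP; split => z /=; rewrite !in_itv/= ?andbT; lra.
  rewrite le_eqVlt; apply/orP; left; apply/eqP; apply: eq_integral => x _.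
  rewrite {2}wv /w /v/= subr0 [f x]fN.
  by congr ((Num.sqrt (f _) - Num.sqrt _) ^+ 2)%:E; [ring|rewrite fN; congr (f _); ring].
rewrite -wv in h *.
set v2 := (\int[lebesgue_measure]_(x in `[r, +oo[) w x)%E in h *.
have v0 : (0 <= v2)%E by apply: integral_ge0 => x _; exact: w0.
apply: (@le_trans _ _ ((2^-1)%:E * (v2 + v2)))%E.
  by apply: lee_wpmul2l; rewrite ?lee_fin ?invr_ge0// leeD2r.
rewrite ge0_muleDr// -ge0_muleDl ?lee_fin ?invr_ge0//.
by rewrite -EFinD (_ : 2^-1 + 2^-1 = 1 :> R) ?mul1e//; lra.
Qed.

Lemma sqr_sqrtB_le (p q : R) : 0 <= q -> q <= p -> (Num.sqrt p - Num.sqrt q) ^+ 2 <= p.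
Proof.
move=> q0 qp; have p0 := le_trans q0 qp.
rewrite -[leRHS](sqr_sqrtr p0) ler_sqr ?nnegrE ?sqrtr_ge0 ?subr_ge0 ?ler_sqrt//.
by rewrite gerBl sqrtr_ge0.
Qed.

Lemma sqr_sqrtB_le_mul (p q k : R) : 0 <= q -> q <= p -> 0 <= k -> p - q <= k * p ->
  (Num.sqrt p - Num.sqrt q) ^+ 2 <= k ^+ 2 * p.
Proof.
move=> q0 qp k0 h; have p0 := le_trans q0 qp.
have := sqr_sqrtr p0; have := sqr_sqrtr q0.
have := sqrtr_ge0 p; have := sqrtr_ge0 q.
have : Num.sqrt q <= Num.sqrt p by rewrite ler_sqrt.
move: (Num.sqrt p) (Num.sqrt q) => a b ba b0 a0 eb ea.
rewrite -ea -exprMn ler_sqr ?nnegrE ?subr_ge0 ?mulr_ge0//.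
move: h; rewrite -ea -eb => h.
have [a00|a1] := eqVneq a 0; first by rewrite a00 mulr0; lra.
have ap : 0 < a by rewrite lt_neqAle eq_sym a1.
rewrite -(ler_pM2r ap); apply: le_trans (_ : a ^+ 2 - b ^+ 2 <= _).
  by rewrite subr_sqr ler_wpM2l ?subr_ge0// lerDl.
by rewrite -mulrA -expr2.
Qed.

Section bound.
Variables (f : density R) (b : nat -> R) (J : nat) (r : R).
Hypotheses (K : sym_mhr f) (Q : quantile_grid (tail f) b J).
Hypotheses (J0 : (0 < J)%N) (r0 : 0 < r) (rs : r * slope b J <= 1).

Let MK := sym_mhr_tail K.

Let r_le_gap j : (j < J)%N -> r <= b j.+1 - b j.
Proof. exact: (grid_gap_ge MK Q (ltW r0) rs). Qed.

Lemma pdf_reflected_ge x : r <= x -> f x <= f (x - 2 * r).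
Proof.
move=> rx; have r1 := r0; case: K => fN fm _.
have [h|h] := leP (2 * r) x; first by apply: fm; lra.
by rewrite [leRHS]fN; apply: fm; lra.
Qed.

(* Monotonicity of [f] bounds the drop of the tail by [2 r f], and the monotone
   hazard turns a drop of the tail into a drop of [f]. *)
Lemma pdf_gap x j : (j <= J)%N -> r <= x -> `|x - 2 * r| <= b j ->
  f (x - 2 * r) - f x <= 2 * r * (f (b j) / tail f (b j)) * f (x - 2 * r).
Proof.
move=> jJ rx; have r1 := r0; case: K => fN fm fh.
set y := `|x - 2 * r|; have y0 : 0 <= y by rewrite normr_ge0.
have -> : f (x - 2 * r) = f y.
  by rewrite /y; case: (ger0P (x - 2 * r)).
have yx : y <= x by rewrite /y ler_norml; apply/andP; split; lra.
have xy : x - y <= 2 * r.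
  have := ler_norm (x - 2 * r); have := ler_norm (- (x - 2 * r)).
  by rewrite normrN -/y; lra.
move=> yb; have Sb := grid_tail_gt0 Q jJ.
have Sy : 0 < tail f y by rewrite (lt_le_trans Sb) ?tail_nincr.
have /andP[_ h1] := tailB_itv fm y0 yx.
have h2 := fh _ _ y0 yx.
have h3 := fh _ _ y0 yb.
have fy0 := pdf_ge0 f y.
have h4 : (x - y) * f y <= 2 * r * f y by apply: ler_wpM2r.
rewrite -(ler_pM2r Sy).
apply: (@le_trans _ _ (f y * (2 * r * f y))).
  rewrite mulrBl lerBlDr; have : f y * (tail f y - tail f x) <= f y * (2 * r * f y).
    by apply: ler_wpM2l => //; exact: le_trans h1 h4.
  by lra.
have -> : 2 * r * (f (b j) / tail f (b j)) * f y * tail f y =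
  (2 * r * f y) * (f (b j) * tail f y / tail f (b j)) by rewrite -!mulrA; ring.
rewrite mulrC; apply: ler_wpM2l; first by rewrite !mulr_ge0// ltW.
by rewrite ler_pdivlMr.
Qed.

(** The half-line from [r] is cut at the grid points shifted by [r]: for [x] below [b j.+1 + r], the
    reflected point [x - 2 * r] stays within [b j.+1] of 0, as [pdf_gap] requires. In the outermost
    cell the trivial coefficient 1 is used. *)
Let edge j : R := if j is 0 then r else b j + r.
Let coef j : R :=
  if (j < J)%N then (2 * r * (f (b j.+1) / tail f (b j.+1))) ^+ 2 else 1.

Let coef_ge0 j : 0 <= coef j.
Proof. by rewrite /coef; case: ifP => // _; rewrite sqr_ge0. Qed.

Lemma sqr_sqrtB_edge x : r <= x ->
  exists2 j, (j <= J)%N & edge j <= x /\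
    (Num.sqrt (f (x - 2 * r)) - Num.sqrt (f x)) ^+ 2 <= coef j * f (x - 2 * r).
Proof.
move=> rx; have qp := pdf_reflected_ge rx.
have [bx|xb] := leP (b J + r) x.
  exists J => //; rewrite /coef ltnn mul1r; split; last by rewrite sqr_sqrtB_le ?pdf_ge0.
  by move: bx; rewrite /edge; case: (J).
have ex : exists j, x < b j.+1 + r by exists J.-1; rewrite prednK.
have [j xj jmin] := ex_minnP ex.
have jJ : (j < J)%N.
  by have := jmin J.-1; rewrite prednK// => /(_ xb); rewrite -ltnS prednK.
exists j; first exact: ltnW.
split.
  rewrite /edge; case: j jmin {xj jJ} => // j jmin.
  by rewrite leNgt; apply/negP => /jmin; rewrite ltnn.
rewrite /coef jJ; apply: sqr_sqrtB_le_mul; rewrite ?pdf_ge0//.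
  by rewrite !mulr_ge0 ?(ltW r0)// ?invr_ge0 ?tail_ge0 ?pdf_ge0.
apply: pdf_gap => //; rewrite ler_norml.
have := r0; have := r_le_gap jJ; have := grid_gt0 MK Q (ltnW jJ).
by move=> ? ? ?; apply/andP; split; lra.
Qed.

(** Undoing the shift leaves the tail at [b j - r], at most the tail one grid point earlier: a
    factor 64, and another to reach [b j.+1] if [j < J]. For [j = 0] the bound of 32 on the first
    grid tail takes this role. *)
Let mass_edge j : (j <= J)%N ->
  (density_law (translate (2 * r) f) `[edge j, +oo[ <=
   (if (j < J)%N then 64 ^+ 2 * tail f (b j.+1) else 64 * tail f (b J))%:E)%E.
Proof.
case: K => fN fm _ jJ; have r1 := r0; case: (Q) => _ Q0 _ Qr.
rewrite density_law_ge// lee_fin.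
case: j jJ => [|j] jJ; rewrite /edge.
  rewrite J0; have := Qr 0 J0; have := tail_le1 f (r - 2 * r).
  by move=> ? /andP[_ ?]; lra.
have jb : tail f (b j.+1 + r - 2 * r) <= tail f (b j).
  by apply: tail_nincr; have := r_le_gap jJ; lra.
apply: (le_trans jb).
have /andP[_ h1] := Qr j jJ.
case: ifP => [j1J|/negbT]; first by have /andP[_ h2] := Qr _ j1J; lra.
by rewrite -leqNgt => Jj; have -> : J = j.+1 by apply/eqP; rewrite eqn_leq Jj jJ.
Qed.

(** Each cell is enlarged to the half-line on its right: since masses decrease geometrically along
    the grid, its order of magnitude is kept. The last summand is the extreme tail. *)
Lemma hellinger2_le :
  (hellinger2 (translate 0 f) (translate (2 * r) f) <=
   (4 * 64 ^+ 2 * r ^+ 2 * (\sum_(j < J) f (b j.+1) ^+ 2 / tail f (b j.+1))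
    + 64 * tail f (b J))%:E)%E.
Proof.
have [fN _ _] := K.
apply: (le_trans (hellinger2_half r fN)).
set p := translate (2 * r) f.
have mp : measurable_fun [set: R] (EFin \o p) := @measurable_EFin_pdf _ p.
have mpA j : measurable_fun [set: R] ((EFin \o p) \_ `[edge j, +oo[).
  by apply/(measurable_restrictT _ _).1 => //; exact: measurable_funTS.
have p0 x : (0 <= (EFin \o p) x)%E by rewrite lee_fin pdf_ge0.
have pA0 j x : (0 <= ((EFin \o p) \_ `[edge j, +oo[) x)%E.
  by rewrite patchE; case: ifP.
apply: (@le_trans _ _ (\int[lebesgue_measure]_x
    (\sum_(j < J.+1) (coef j)%:E * ((EFin \o p) \_ `[edge j, +oo[) x)))%E.
  rewrite integral_mkcond; apply: ge0_le_integral => //=.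
  - by move=> x _; rewrite patchE; case: ifP => // _; rewrite lee_fin sqr_ge0.
  - apply/(measurable_restrictT _ _).1 => //; apply: measurable_funTS.
    apply/measurable_EFinP; apply: measurable_funX.
    exact: (measurable_funB (measurable_sqrt_pdf p) (measurable_sqrt_pdf f)).
  - by apply: emeasurable_sum => j; apply: measurable_funeM; exact: mpA.
  - move=> x _; have s0 : (0 <= \sum_(j < J.+1) (coef j)%:E * ((EFin \o p) \_ `[edge j, +oo[) x)%E.
      by apply: sume_ge0 => j _; rewrite mule_ge0 ?lee_fin.
    rewrite {1}patchE; case: ifPn => // /set_mem/=; rewrite in_itv/= andbT => rx.
    have [j jJ [ex hx]] := sqr_sqrtB_edge rx.
    rewrite (bigD1 (Ordinal (jJ : (j < J.+1)%N)))//=.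
    rewrite -[leLHS]adde0; apply: leeD; last first.
      by apply: sume_ge0 => i _; rewrite mule_ge0 ?lee_fin.
    by rewrite patchE mem_set/= ?in_itv/= ?andbT// lee_fin.
rewrite ge0_integral_sum//; last 2 first.
- by move=> j; apply: measurable_funeM; exact: mpA.
- by move=> j x _; rewrite mule_ge0 ?lee_fin.
have E (j : 'I_J.+1) : (\int[lebesgue_measure]_x ((coef j)%:E * ((EFin \o p) \_ `[edge j, +oo[) x)
   <= (coef j * (if (j < J)%N then 64 ^+ 2 * tail f (b j.+1) else 64 * tail f (b J)))%:E)%E.
  rewrite ge0_integralZl ?lee_fin//; last exact: mpA.
  rewrite -integral_mkcond EFinM; apply: lee_wpmul2l; rewrite ?lee_fin//.
  by apply: mass_edge; rewrite -ltnS.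
apply: (le_trans (lee_sum _ (fun j _ => E j))).
rewrite sumEFin lee_fin big_ord_recr/= ltnn /coef ltnn mul1r lerD2r.
rewrite mulr_sumr; apply: ler_sum => j _; rewrite ltn_ord.
have Sj := grid_tail_gt0 Q (ltn_ord j).
rewrite le_eqVlt; apply/orP; left; apply/eqP.
by field; rewrite gt_eqF.
Qed.

End bound.
End hellinger_bound.

(** * Exponential moments *)

(** [expR x] is the inverse of the square of [expR (- (x / 2))], which is at least [1 - x / 2]. What
    remains is polynomial, and no lower bound on [x] enters. *)
Lemma expR_le_quadratic {R : realType} (x : R) : x <= 1 / 4 -> expR x <= 1 + x + x ^+ 2.
Proof.
move=> x1; have h := expR_ge1Dx (- (x / 2)).
have h0 : 0 < 1 - x / 2 by lra.
have e : expR x * expR (- (x / 2)) ^+ 2 = 1.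
  by rewrite expr2 -!expRD (_ : x + _ = 0) ?expR0//; field.
have h2 : (1 - x / 2) ^+ 2 <= expR (- (x / 2)) ^+ 2.
  by rewrite ler_sqr ?nnegrE ?expR_ge0// ltW.
have h3 : expR x * (1 - x / 2) ^+ 2 <= 1.
  by rewrite -[leRHS]e; apply: ler_wpM2l => //; exact: expR_ge0.
have h4 : 1 <= (1 + x + x ^+ 2) * (1 - x / 2) ^+ 2.
  have -> : (1 + x + x ^+ 2) * (1 - x / 2) ^+ 2 =
    1 + x ^+ 2 * ((x ^+ 2 - 3 * x + 1) / 4) by field.
  rewrite lerDl mulr_ge0 ?sqr_ge0// divr_ge0// expr2; nra.
by rewrite -(ler_pM2r (exprn_gt0 2 h0)); exact: le_trans h3 h4.
Qed.

Section mean.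
Context d {T : measurableType d} {R : realType} (P : probability T R).
Implicit Types (g h : T -> R) (v w k : R).

Definition has_mean g v : Prop :=
  P.-integrable [set: T] (EFin \o g) /\ (\int[P]_x (g x)%:E = v%:E)%E.

Lemma has_mean_cst k : has_mean (cst k) k.
Proof.
split; first exact: finite_measure_integrable_cst.
transitivity (k%:E * P [set: T])%E; first exact: (integral_cst P measurableT k%:E).
by rewrite probability_setT mule1.
Qed.

Lemma has_meanD g h v w : has_mean g v -> has_mean h w ->
  has_mean (fun x => g x + h x) (v + w).
Proof.
move=> [ig eg] [ih eh]; split; first exact: (integrableD measurableT ig ih).
by under eq_integral do rewrite EFinD; rewrite integralD// eg eh.
Qed.

Lemma has_meanZ k g v : has_mean g v -> has_mean (fun x => k * g x) (k * v).
Proof.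
move=> [ig eg]; split; first exact: (integrableZl measurableT k ig).
by under eq_integral do rewrite EFinM; rewrite integralZl// eg.
Qed.

Lemma has_mean_sum n (g : nat -> T -> R) (v : nat -> R) :
  (forall i, (i < n)%N -> has_mean (g i) (v i)) ->
  has_mean (fun x => \sum_(i < n) g i x) (\sum_(i < n) v i).
Proof.
elim: n => [|n IH] h.
  rewrite big_ord0; under [X in has_mean X]eq_fun do rewrite big_ord0.
  exact: has_mean_cst.
rewrite big_ord_recr; under [X in has_mean X]eq_fun do rewrite big_ord_recr.
by apply: has_meanD; [apply: IH => i iN; apply: h; exact: ltnW|exact: h].
Qed.

Lemma has_mean_bool (p : T -> bool) v : measurable [set x | p x] ->
  P [set x | p x] = v%:E -> has_mean (fun x => (p x)%:R) v.
Proof.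
move=> mp pv.
have -> : (fun x => (p x)%:R) = \1_([set x | p x]) :> (T -> R).
  apply/funext => x; rewrite indicE; congr (nat_of_bool _)%:R.
  by apply/idP/idP; rewrite inE.
split; first exact: integrable_indic mp.
by rewrite integral_indic// setIT.
Qed.

Lemma mgf_le_mean (phi g : T -> R) v : measurable_fun setT phi -> has_mean g v ->
  (forall x, expR (phi x) <= g x) ->
  (\int[P]_x (expR (phi x))%:E <= v%:E)%E.
Proof.
move=> mphi [ig <-] h; apply: ge0_le_integral => //.
- by apply/measurable_EFinP; exact: measurableT_comp.
- exact: measurable_int ig.
- by move=> x _; rewrite lee_fin.
Qed.

End mean.

Section symmetric_mgf.
Context d {T : measurableType d} {R : realType} (P : probability T R).
Variables (S : R -> R) (Y : T -> R).
Hypotheses (mY : measurable_fun [set: T] Y).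
Hypotheses (PU : forall t, P [set x | t <= Y x] = (S t)%:E).
Hypotheses (PL : forall t, P [set x | Y x <= - t] = (S t)%:E).

Lemma measurable_bool_fun (p : T -> bool) : measurable [set x | p x] ->
  measurable_fun [set: T] (fun x => (p x)%:R : R).
Proof.
move=> mp.
have -> : (fun x => (p x)%:R) = \1_([set x | p x]) :> (T -> R).
  apply/funext => x; rewrite indicE; congr (nat_of_bool _)%:R.
  by apply/idP/idP; rewrite inE.
exact: measurable_indic.
Qed.

(** Bounding the exponential by a quadratic and the squared score by [score_sqr_le] leaves a linear
    combination of tail indicators, with mean exactly [1 - score_gain S b J r]. *)
Lemma score_mgf_le (b : nat -> R) J (r : R) :
  0 < b 0%N -> (forall j, (j < J)%N -> b j < b j.+1) ->
  0 <= r -> 3 / 2048 * r * slope b J <= 1 / 4 ->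
  (\int[P]_x (expR (3 / 2048 * r * score b J (Y x - r)))%:E
    <= (1 - score_gain S b J r)%:E)%E.
Proof.
move=> b0 bS r0 rs.
have lam0 : 0 <= 3 / 2048 * r by apply: mulr_ge0 r0; rewrite divr_ge0 ?ler0n.
have mu j : measurable [set x | b j.+1 <= Y x - r].
  rewrite (_ : [set _ | _] = [set x | b j.+1 + r <= Y x]).
    exact: measurable_le_set.
  by apply/seteqP; split => x /=; lra.
have ml j : measurable [set x | Y x - r <= - b j.+1].
  rewrite (_ : [set _ | _] = [set x | Y x <= - (b j.+1 - r)]).
    exact: measurable_ge_set.
  by apply/seteqP; split => x /=; lra.
have hu j : has_mean P (fun x => (b j.+1 <= Y x - r)%R%:R) (S (b j.+1 + r)).
  apply: has_mean_bool => //; rewrite -PU; congr (P _).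
  by apply/seteqP; split => x /=; lra.
have hl j : has_mean P (fun x => (Y x - r <= - b j.+1)%R%:R) (S (b j.+1 - r)).
  apply: has_mean_bool => //; rewrite -PL; congr (P _).
  by apply/seteqP; split => x /=; lra.
set lam := 3 / 2048 * r in lam0 rs *.
pose a j := slope b j.+1 - slope b j.
pose q j := slope b j.+1 ^+ 2 - slope b j ^+ 2.
have hs := has_mean_sum (fun j (_ : (j < J)%N) =>
  has_meanD (has_meanZ (lam * a j + lam ^+ 2 * q j) (hu j))
            (has_meanZ (- (lam * a j) + lam ^+ 2 * q j) (hl j))).
have := has_meanD (has_mean_cst P 1) hs.
have -> : 1 + \sum_(j < J) ((lam * a j + lam ^+ 2 * q j) * S (b j.+1 + r) +
     (- (lam * a j) + lam ^+ 2 * q j) * S (b j.+1 - r)) = 1 - score_gain S b J r.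
  rewrite /score_gain /score_mean /score_var -/lam opprB; congr (_ + _).
  rewrite !mulr_sumr -sumrN -big_split; apply: eq_bigr => j _ /=.
  rewrite /a /q; rewrite -[Num.max _ _]/(slope b j.+1); ring.
move=> hm; apply: (mgf_le_mean _ hm).
  apply: measurable_funM => //; rewrite /score.
  apply: measurable_sum => j; apply: measurable_funM => //.
  by apply: measurable_funB; exact: measurable_bool_fun.
move=> x /=.
apply: (le_trans (expR_le_quadratic _)).
  by apply: le_trans rs; apply: ler_wpM2l => //; exact: score_le.
rewrite -addrA lerD2l exprMn.
have h := score_sqr_le (Y x - r) b0 bS.
apply: le_trans (lerD (lexx _) (ler_wpM2l (sqr_ge0 lam) h)) _.
rewrite /score !mulr_sumr -big_split; apply: ler_sum => j _ /=.
by rewrite /a /q -[Num.max _ _]/(slope b j.+1) le_eqVlt; apply/orP; left; apply/eqP; ring.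
Qed.

Lemma count_low_mgf_le (t p : R) : 0 <= p <= 1 / 16 -> S t = 2 * p ->
  (\int[P]_x (expR (1 / 4 * (p - (t <= Y x)%R%:R)))%:E <= (1 - p / 16)%:E)%E.
Proof.
move=> /andP[p0 p1] St.
have h : has_mean P (fun x => (t <= Y x)%R%:R) (2 * p).
  by rewrite -St; apply: has_mean_bool => //; exact: measurable_le_set.
(* The coefficients are those of [1 + x + x ^+ 2] at [x = 1 / 4 * (p - i)], where [i] is the
   indicator and [i ^+ 2 = i]. *)
have hs := has_meanD (has_mean_cst P (1 + 1 / 4 * p + 1 / 16 * p ^+ 2))
  (has_meanZ (- 1 / 4 - 1 / 8 * p + 1 / 16) h).
apply: (@le_trans _ _ (1 + 1 / 4 * p + 1 / 16 * p ^+ 2 +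
    (- 1 / 4 - 1 / 8 * p + 1 / 16) * (2 * p))%:E).
  apply: mgf_le_mean hs _.
    apply: measurable_funM => //; apply: measurable_funB => //.
    by apply: measurable_bool_fun; exact: measurable_le_set.
  move=> x /=; apply: (le_trans (expR_le_quadratic _)).
    by case: (t <= Y x) => /=; lra.
  by case: (t <= Y x) => /=; rewrite ?expr2; nra.
by rewrite lee_fin; nra.
Qed.

Lemma count_high_mgf_le (t p : R) : 0 <= p <= 1 / 16 -> S t = p / 2 ->
  (\int[P]_x (expR (1 / 4 * ((t <= Y x)%R%:R - p)))%:E <= (1 - p / 16)%:E)%E.
Proof.
move=> /andP[p0 p1] St.
have h : has_mean P (fun x => (t <= Y x)%R%:R) (p / 2).
  by rewrite -St; apply: has_mean_bool => //; exact: measurable_le_set.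
have hs := has_meanD (has_mean_cst P (1 - 1 / 4 * p + 1 / 16 * p ^+ 2))
  (has_meanZ (1 / 4 - 1 / 8 * p + 1 / 16) h).
apply: (@le_trans _ _ (1 - 1 / 4 * p + 1 / 16 * p ^+ 2 +
    (1 / 4 - 1 / 8 * p + 1 / 16) * (p / 2))%:E).
  apply: mgf_le_mean hs _.
    apply: measurable_funM => //; apply: measurable_funB => //.
    by apply: measurable_bool_fun; exact: measurable_le_set.
  move=> x /=; apply: (le_trans (expR_le_quadratic _)).
    by case: (t <= Y x) => /=; lra.
  by case: (t <= Y x) => /=; rewrite ?expr2; nra.
by rewrite lee_fin; nra.
Qed.

End symmetric_mgf.

(** * The estimator *)

Section estimator.
Context {R : realType}.
Implicit Types (s : seq R) (p e : R).

Definition level (j : nat) : R := 16^-1 ^+ j.+1.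

(** [e] is a sign: [e = - 1] reflects the sample, so that its lower quantiles are treated as upper
    ones. *)
Definition excess e p s (x : R) : R := \sum_(w <- s) ((x <= e * w)%R%:R - p).

Definition sample_quantile e p s : R := crossing (excess e p s).

(* Half the distance between matching upper and lower sample quantiles: an
   estimate of the [level j] quantile of [|X - mu|] that does not involve [mu]. *)
Definition half_width s (j : nat) : R :=
  (sample_quantile 1 (level j) s + sample_quantile (- 1) (level j) s) / 2.

(** [s1] is the half being centred; [s2] is the pilot half that supplies the grid. *)
Definition balance J s1 s2 (x : R) : R :=
  \sum_(w <- s1) score (half_width s2) J (w - x).

Definition split_center J s1 s2 : R := crossing (balance J s1 s2).

Lemma excess_nincr e p s (u v : R) : u <= v -> excess e p s v <= excess e p s u.
Proof.
move=> uv; apply: ler_sum => w _; rewrite lerD2r ler_nat.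
by case: (leP v (e * w)) => // vw; rewrite (le_trans uv vw).
Qed.

Lemma balance_nincr J s1 s2 (u v : R) : u <= v -> balance J s1 s2 v <= balance J s1 s2 u.
Proof. by move=> uv; apply: ler_sum => w _; apply: score_homo; rewrite lerD2l lerN2. Qed.

(** The inverse is continuous off 0, and the single point 0 is treated apart. *)
Lemma measurable_invr : measurable_fun [set: R] (@GRing.inv R).
Proof.
have o0 : open (~` [set 0 : R]) by apply: closed_openC; exact: closed_eq.
rewrite -(setvU [set 0 : R]); apply/measurable_funU => //.
  exact: open_measurable.
split; last exact: measurable_fun_set1.
apply: open_continuous_measurable_fun => // x /set_mem/= /eqP x0.
exact: inv_continuous.
Qed.

Section measurability.
Context d {D : measurableType d}.

Lemma measurable_bool_le (g h : D -> R) :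
  measurable_fun [set: D] g -> measurable_fun [set: D] h ->
  measurable_fun [set: D] (fun x => (g x <= h x)%R%:R : R).
Proof.
move=> mg mh; apply: measurable_bool_fun.
by rewrite -[X in measurable X]setTI; exact: measurable_fun_le.
Qed.

Lemma measurable_sample_quantile e p N (g : 'I_N -> D -> R) :
  (forall i, measurable_fun [set: D] (g i)) ->
  measurable_fun [set: D] (fun x => sample_quantile e p [seq g i x | i : 'I_N]).
Proof.
move=> mg; apply: measurable_crossing => [w u v|u]; first exact: excess_nincr.
rewrite (_ : (fun _ => _) = fun x => \sum_(i < N) ((u <= e * g i x)%R%:R - p)); last first.
  by apply/funext => x; rewrite /excess big_map big_enum.
apply: measurable_sum => i; apply: measurable_funB => //.
by apply: measurable_bool_le => //; exact: measurable_funM.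
Qed.

Lemma measurable_half_width N (g : 'I_N -> D -> R) j :
  (forall i, measurable_fun [set: D] (g i)) ->
  measurable_fun [set: D] (fun x => half_width [seq g i x | i : 'I_N] j).
Proof.
move=> mg; apply: measurable_funM => //.
by apply: measurable_funD; exact: measurable_sample_quantile.
Qed.

Lemma measurable_slope (b : D -> nat -> R) j :
  (forall i, measurable_fun [set: D] (b ^~ i)) ->
  measurable_fun [set: D] (fun x => slope (b x) j).
Proof.
move=> mb; elim: j => [|j IH] /=; first exact: measurable_cst.
apply: measurable_maxr => //; apply: (measurableT_comp measurable_invr).
exact: measurable_funB.
Qed.

Lemma measurable_score (b : D -> nat -> R) J (g : D -> R) :
  (forall i, measurable_fun [set: D] (b ^~ i)) -> measurable_fun [set: D] g ->
  measurable_fun [set: D] (fun x => score (b x) J (g x)).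
Proof.
move=> mb mg; apply: measurable_sum => j; apply: measurable_funM.
  by apply: measurable_funB; exact: measurable_slope.
apply: measurable_funB; apply: measurable_bool_le => //.
exact: measurableT_comp.
Qed.

Lemma measurable_split_center J N M (g : 'I_N -> D -> R) (h : 'I_M -> D -> R) :
  (forall i, measurable_fun [set: D] (g i)) ->
  (forall i, measurable_fun [set: D] (h i)) ->
  measurable_fun [set: D]
    (fun x => split_center J [seq g i x | i : 'I_N] [seq h i x | i : 'I_M]).
Proof.
move=> mg mh; apply: measurable_crossing => [w u v|u]; first exact: balance_nincr.
rewrite (_ : (fun _ => _) = fun x =>
    \sum_(i < N) score (half_width [seq h i x | i : 'I_M]) J (g i x - u)); last first.
  by apply/funext => x; rewrite /balance big_map big_enum.
apply: measurable_sum => i; apply: measurable_score.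
  by move=> j; exact: measurable_half_width.
exact: measurable_funB.
Qed.

End measurability.

Lemma tcat_surj k m (X : (k + m).-tuple R) : exists y z, X = tcat y z.
Proof.
exists [tuple tnth X (lshift m i) | i < k], [tuple tnth X (rshift k i) | i < m].
apply: eq_from_tnth => i; case: (split_ordP i) => j ->.
  by rewrite tnth_lshift tnth_mktuple.
by rewrite tnth_rshift tnth_mktuple.
Qed.

Lemma take_tcat k m (y : k.-tuple R) (z : m.-tuple R) : take k (tcat y z) = y.
Proof. by rewrite /= take_size_cat// size_tuple. Qed.

Lemma drop_tcat k m (y : k.-tuple R) (z : m.-tuple R) : drop k (tcat y z) = z.
Proof. by rewrite /= drop_size_cat// size_tuple. Qed.

Lemma measurable_split_estimator n k J : (k <= n)%N ->
  measurable_fun [set: n.-tuple (measurableTypeR R)]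
    (fun X => split_center J (take k X) (drop k X) : R).
Proof.
move=> kn; have [m ->] : exists m, n = (k + m)%N by exists (n - k)%N; rewrite subnKC.
rewrite (_ : (fun _ => _) = fun X : (k + m).-tuple (measurableTypeR R) =>
  split_center J [seq tnth X (lshift m i) | i : 'I_k] [seq tnth X (rshift k i) | i : 'I_m]).
  by apply: measurable_split_center => i; exact: measurable_tnth.
apply/funext => X; have [y [z ->]] := tcat_surj X.
rewrite take_tcat drop_tcat; congr (split_center J _ _).
  rewrite -[LHS]map_tnth_enum; apply: eq_map => i; by rewrite tnth_lshift.
rewrite -[LHS]map_tnth_enum; apply: eq_map => i; by rewrite tnth_rshift.
Qed.

End estimator.

(** * Deviation bounds *)

Section sampling.
Context {R : realType}.
Variables (f : density R) (mu : R).
Hypothesis K : sym_mhr f.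

Let P : probability (measurableTypeR R) R := density_law (translate mu f).

Let fN : forall x, f x = f (- x). Proof. by case: K. Qed.

Lemma signed_deviation_ge (e t : R) : e = 1 \/ e = - 1 ->
  P [set x : R | t <= e * (x - mu)] = (tail f t)%:E.
Proof.
move=> [->|->].
  rewrite [X in P X](_ : _ = `[t + mu, +oo[%classic).
    by have := density_law_ge fN mu (t + mu); rewrite addrK.
  by apply/seteqP; split => x /=; rewrite in_itv/= andbT mul1r lerBrDr.
rewrite [X in P X](_ : _ = `]-oo, mu - t]%classic).
  by have := density_law_le fN mu (mu - t); rewrite subKr.
by apply/seteqP; split => x /=; rewrite in_itv/= mulN1r opprB; lra.
Qed.

Lemma signed_deviation_le (e t : R) : e = 1 \/ e = - 1 ->
  P [set x : R | e * (x - mu) <= - t] = (tail f t)%:E.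
Proof.
move=> he; rewrite -(@signed_deviation_ge (- e)); last first.
  by case: he => ->; [right|left; rewrite opprK].
by congr (P _); apply/seteqP; split => x /=; rewrite mulNr lerNr.
Qed.

Lemma measurable_signed_deviation (e : R) :
  measurable_fun [set: measurableTypeR R] (fun x : R => e * (x - mu)).
Proof. by apply: measurable_funM => //; exact: measurable_funB. Qed.

Lemma level_gt0 j : 0 < level j :> R.
Proof. by rewrite exprn_gt0// invr_gt0 ltr0n. Qed.

Lemma levelS j : level j = 16 * level j.+1 :> R.
Proof. by rewrite /level [in RHS]exprS mulrA divff ?mul1r// pnatr_eq0. Qed.

Lemma level_le j : level j <= 1 / 16 :> R.
Proof.
elim: j => [|j IH]; first by rewrite /level expr1 div1r.
by have := levelS j; have := level_gt0 j.+1; lra.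
Qed.

Lemma sample_quantile_itv (e p : R) (s : seq R) (u v : R) :
  ~ (0 <= \sum_(w <- s) 1 / 4 * (p - (u <= e * (w - mu))%R%:R)) ->
  ~ (0 <= \sum_(w <- s) 1 / 4 * ((v <= e * (w - mu))%R%:R - p)) ->
  e * mu + u <= sample_quantile e p s <= e * mu + v.
Proof.
move=> /negP h1 /negP h2; apply: crossing_itv; first exact: excess_nincr.
- move: h1; rewrite -ltNge -mulr_sumr pmulr_rlt0; last lra.
  rewrite -oppr_gt0 -sumrN => /lt_le_trans; apply.
  rewrite le_eqVlt; apply/orP; left; apply/eqP; apply: eq_bigr => w _.
  by rewrite opprB mulrBr lerBrDl.
- move: h2; rewrite -ltNge -mulr_sumr pmulr_rlt0; last lra.
  move=> /ltW; apply: le_trans.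
  rewrite le_eqVlt; apply/orP; left; apply/eqP; apply: eq_bigr => w _.
  by rewrite mulrBr lerBrDl.
Qed.

(** Twice and half the level leave a constant-factor margin: the proportion of points beyond [u] or
    [v] falls on the wrong side of [level j] with Chernoff exponent at least [level j / 16] per
    observation. *)
Lemma pilot_quantile m j (e : R) : e = 1 \/ e = - 1 ->
  exists B : set (m.-tuple (measurableTypeR R)), [/\ measurable B,
    (iid P m B <= (2 * expR (- (m%:R * level j / 16)))%:E)%E &
    forall z : m.-tuple R, ~ B z -> exists u v, [/\ 0 <= u, tail f u = 2 * level j,
      tail f v = level j / 2 & e * mu + u <= sample_quantile e (level j) z <= e * mu + v]].
Proof.
move=> he; have p0 := level_gt0 j; have p1 := level_le j.
have [u u0 fu] : exists2 x, 0 <= x & tail f x = 2 * level j by apply: tail_quantile => //; lra.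
have [v v0 fv] : exists2 x, 0 <= x & tail f x = level j / 2 by apply: tail_quantile => //; lra.
pose phi1 (x : R) : R := 1 / 4 * (level j - (u <= e * (x - mu))%R%:R).
pose phi2 (x : R) : R := 1 / 4 * ((v <= e * (x - mu))%R%:R - level j).
have mb w : measurable_fun [set: measurableTypeR R] (fun x => (w <= e * (x - mu))%R%:R : R).
  by apply: measurable_bool_le => //; exact: measurable_signed_deviation.
have m1 : measurable_fun [set: measurableTypeR R] phi1.
  by apply: measurable_funM => //; exact: measurable_funB.
have m2 : measurable_fun [set: measurableTypeR R] phi2.
  by apply: measurable_funM => //; exact: measurable_funB.
have p01 : 0 <= (level j : R) <= 1 / 16 by rewrite (ltW p0).
have e1 : ((1 - level j / 16)%:E <= (expR (- (level j / 16)) : R)%:E)%E.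
  by rewrite lee_fin expR_ge1Dx.
have e2 : expR (- (level j / 16)) ^+ m = expR (- (m%:R * level j / 16)) :> R.
  by rewrite -expRM_natl mulrN mulrA.
have := count_low_mgf_le (measurable_signed_deviation e)
  (fun t => signed_deviation_ge t he) p01 fu.
move=> /le_trans/(_ e1)/(iid_chernoff m m1); rewrite e2 => c1.
have := count_high_mgf_le (measurable_signed_deviation e)
  (fun t => signed_deviation_ge t he) p01 fv.
move=> /le_trans/(_ e1)/(iid_chernoff m m2); rewrite e2 => c2.
exists ([set z | 0 <= \sum_(i < m) phi1 (tnth z i)] `|`
        [set z | 0 <= \sum_(i < m) phi2 (tnth z i)]); split.
- by apply: measurableU; exact: measurable_sum_ge0.
- apply: le_trans (measureU2 _ _ _) _; try exact: measurable_sum_ge0.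
  by rewrite mulr_natl mulr2n EFinD; exact: leeD.
- move=> z /not_orP[z1 z2]; exists u, v; split => //.
  apply: sample_quantile_itv; rewrite big_tuple; [exact: z1|exact: z2].
Qed.

(** The brackets of the upper and of the lower quantile come from separate existence statements, so
    only their tails are known to agree; by monotonicity the tail is constant between them. *)
Lemma tail_midpoint (u v : R) : tail f u = tail f v -> tail f ((u + v) / 2) = tail f u.
Proof.
move=> uv; apply/eqP; rewrite eq_le.
case: (leP u v) => h; apply/andP; split.
- by apply: tail_nincr; clear uv; lra.
- by rewrite uv; apply: tail_nincr; clear uv; lra.
- by rewrite uv; apply: tail_nincr; clear uv; lra.
- by apply: tail_nincr; clear uv; lra.
Qed.

Lemma pilot_good m J :
  exists G : set (m.-tuple (measurableTypeR R)), [/\ measurable G,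
    (iid P m (~` G) <= (\sum_(j < J.+1) 4 * expR (- (m%:R * level j / 16)))%:E)%E &
    forall z : m.-tuple R, G z -> quantile_grid (tail f) (half_width z) J /\
      level J / 2 <= tail f (half_width z J) <= 2 * level J].
Proof.
have /choice[B1 hB1] : forall j, _ := fun j => @pilot_quantile m j 1 (or_introl erefl).
have /choice[B2 hB2] : forall j, _ := fun j => @pilot_quantile m j (- 1) (or_intror erefl).
pose B j := B1 j `|` B2 j.
have mB j : measurable (B j).
  by apply: measurableU; [have [] := hB1 j|have [] := hB2 j].
exists (~` \big[setU/set0]_(j < J.+1) B j); split.
- by apply: measurableC; exact: bigsetU_measurable.
- rewrite setCK; apply: le_trans (Boole_inequality _ _) _ => //.
  rewrite -sumEFin; apply: lee_sum => j _.
  apply: le_trans (measureU2 _ _ _) _; [by have [] := hB1 j|by have [] := hB2 j|].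
  rewrite (_ : 4 = 2 + 2 :> R); last ring.
  by rewrite mulrDl EFinD; apply: leeD; [have [] := hB1 j|have [] := hB2 j].
- move=> z Gz.
  have hS j : (j <= J)%N -> level j / 2 <= tail f (half_width z j) <= 2 * level j.
    move=> jJ; have nB : ~ B j z.
      move=> Bz; apply: Gz; rewrite -bigcup_mkord_ord; exists j => //=.
      by rewrite inordK.
    have /not_orP[n1 n2] := nB.
    have [_ _ /(_ z n1)[u1 [v1 [u10 fu1 fv1 /andP[h1 h1']]]]] := hB1 j.
    have [_ _ /(_ z n2)[u2 [v2 [u20 fu2 fv2 /andP[h2 h2']]]]] := hB2 j.
    (* The two brackets are centred at [mu] and [- mu], which cancel in [half_width]. *)
    apply/andP; split.
      rewrite -fv1 -(@tail_midpoint v1 v2) ?fv1//; apply: tail_nincr.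
      by move: h1' h2'; rewrite /half_width; lra.
    rewrite -fu1 -(@tail_midpoint u1 u2) ?fu1//; apply: tail_nincr.
    by move: h1 h2; rewrite /half_width; lra.
  split; last exact: hS.
  have h0 := hS _ (leq0n J); have hJ := hS _ (leqnn J).
  have l0 : level 0 = 1 / 16 :> R by rewrite /level expr1 div1r.
  move: hS h0 hJ l0 levelS level_gt0 (tail_nincr f) (tail0_ge fN).
  generalize (@level R) (half_width z) (tail f).
  move=> lev b T hS /andP[h1 h2] /andP[h3 _] l0 lS lev0 Tm T0.
  rewrite l0 in h1 h2; split.
  + by rewrite ltNge; apply/negP => /Tm; lra.
  + by lra.
  + by have := lev0 J; lra.
  + move=> j jJ; move: (hS _ (ltnW jJ)) (hS _ jJ) (lS j) => /andP[a1 a2] /andP[a3 a4].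
    by move=> ?; apply/andP; split; lra.
Qed.

(** The grid is frozen here. The two events are Chernoff events for the sample and its reflection at
    the smaller shift [r']; monotonicity of the score carries the signs out to [mu + r] and
    [mu - r]. *)
Lemma split_center_far k (b : nat -> R) J (r r' : R) :
  0 < b 0%N -> (forall j, (j < J)%N -> b j < b j.+1) ->
  0 < r' -> r' <= r -> r' * slope b J <= 1 ->
  exists A : set (k.-tuple (measurableTypeR R)), [/\ measurable A,
    (iid P k A <= (2 * expR (- (k%:R * score_gain (tail f) b J r')))%:E)%E &
    forall y : k.-tuple R, ~ A y ->
      \sum_(w <- y) score b J (w - (mu + r)) < 0 < \sum_(w <- y) score b J (w - (mu - r))].
Proof.
move=> b0 bS r0 rr rs.
have rs' : 3 / 2048 * r' * slope b J <= 1 / 4.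
  rewrite -mulrA; move: (r' * slope b J) rs => q; lra.
pose phi (e x : R) : R := 3 / 2048 * r' * score b J (e * (x - mu) - r').
have mphi e : measurable_fun [set: measurableTypeR R] (phi e).
  apply: measurable_funM => //; apply: measurable_score => //.
  by apply: measurable_funB => //; exact: measurable_signed_deviation.
have c e : e = 1 \/ e = - 1 ->
  (iid P k [set y | (0 <= \sum_(i < k) phi e (tnth y i))%R] <=
   (expR (- (k%:R * score_gain (tail f) b J r')))%:E)%E.
  move=> he; rewrite -mulrN expRM_natl; apply: iid_chernoff (mphi e) _.
  apply: (@le_trans _ _ (1 - score_gain (tail f) b J r')%:E); last first.
    by rewrite lee_fin expR_ge1Dx.
  exact: (score_mgf_le (measurable_signed_deviation e) (fun t => signed_deviation_ge t he)
     (fun t => signed_deviation_le t he) b0 bS (ltW r0) rs').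
exists ([set y | 0 <= \sum_(i < k) phi 1 (tnth y i)] `|`
        [set y | 0 <= \sum_(i < k) phi (- 1) (tnth y i)]); split.
- by apply: measurableU; exact: measurable_sum_ge0.
- apply: le_trans (measureU2 _ _ _) _; try exact: measurable_sum_ge0.
  by rewrite mulr_natl mulr2n EFinD; apply: leeD; apply: c; [left|right].
have lam0 : 0 < 3 / 2048 * r' by apply: mulr_gt0 r0; rewrite divr_gt0 ?ltr0n.
move=> y /not_orP[/negP h1 /negP h2]; apply/andP; split.
- move: h1; rewrite -ltNge -mulr_sumr pmulr_rlt0// => h1.
  apply: le_lt_trans h1; rewrite big_tuple; apply: ler_sum => i _.
  by apply: score_homo; lra.
- move: h2; rewrite -ltNge -mulr_sumr pmulr_rlt0// -oppr_gt0 => h2.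
  apply: (lt_le_trans h2); rewrite big_tuple -sumrN; apply: ler_sum => i _.
  by rewrite -score_opp; apply: score_homo; lra.
Qed.

End sampling.

(** * Accuracy of the split estimator *)

Section accuracy.
Context {R : realType}.

Lemma kappa_gt0 : 0 < (3 / 2048) ^+ 2 :> R.
Proof. by apply: exprn_gt0; rewrite divr_gt0 ?ltr0n. Qed.

(** The tail part [64 * s] takes at most half of [t], so the other half is controlled by [w]. *)
Lemma gain_exists_arith (k g t s w : R) : 0 < k -> 128 * s <= t ->
  t < 4 * 64 ^+ 2 * w + 64 * s -> k * (3 / 4) * w <= 63 ^+ 2 * g ->
  k * (3 / 4) * (t / 2) <= 4 * 64 ^+ 2 * 63 ^+ 2 * g.
Proof.
move=> k0 st tw wg.
have h1 : t / 2 <= 4 * 64 ^+ 2 * w by clear wg k0; lra.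
have h2 := ler_wpM2l (ltW k0) h1; clear k0 st tw h1.
have -> : k * (3 / 4) * (t / 2) = 3 / 4 * (k * (t / 2)) by ring.
lra.
Qed.

(* When [r * slope b J > 1], the shift exceeds the last gap: the exponent at
   [(slope b J)^-1 < r] is then already of the order of the tail mass. *)
Lemma gain_exists (f : density R) (b : nat -> R) J (r t : R) :
  sym_mhr f -> quantile_grid (tail f) b J -> (0 < J)%N -> 0 < r ->
  (t%:E < hellinger2 (translate 0 f) (translate (2 * r) f))%E ->
  128 * tail f (b J) <= t ->
  exists r', [/\ 0 < r', r' <= r, r' * slope b J <= 1 &
    (3 / 2048) ^+ 2 * (3 / 4) * (t / 2) <= 4 * 64 ^+ 2 * 63 ^+ 2 * score_gain (tail f) b J r' \/
    (3 / 2048) ^+ 2 * tail f (b J) <= score_gain (tail f) b J r'].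
Proof.
move=> K Q J0 r0 tH St.
have [rs|rs] := leP (r * slope b J) 1.
  exists r; split => //; left.
  have h1 := lt_le_trans tH (hellinger2_le K Q J0 r0 rs).
  rewrite lte_fin -[4 * 64 ^+ 2 * r ^+ 2 * _]mulrA in h1.
  have := score_gain_small (sym_mhr_tail K) Q r0 rs.
  rewrite -[(3 / 2048) ^+ 2 * (3 / 4) * r ^+ 2 * _]mulrA.
  exact: (gain_exists_arith kappa_gt0 St h1).
have s0 := grid_slope_gt0 (sym_mhr_tail K) Q J0.
exists (slope b J)^-1; split.
- by rewrite invr_gt0.
- by rewrite -[leLHS]mul1r ler_pdivrMr// ltW.
- by rewrite mulVf// gt_eqF.
- by right; exact: score_gain_large (sym_mhr_tail K) Q J0.
Qed.

(* Each term is the 16th power of the next one. *)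
Lemma expR_level_sum m J : expR (- (m%:R * level J / 16)) <= 1 / 2 :> R ->
  \sum_(j < J.+1) expR (- (m%:R * level j / 16)) <= 2 * expR (- (m%:R * level J / 16)) :> R.
Proof.
elim: J => [|J IH] h.
  by rewrite big_ord1 ler_peMl ?expR_ge0// ler1n.
rewrite big_ord_recr/=; set x := expR _ in h *.
have x0 : 0 <= x by exact: expR_ge0.
have e : expR (- (m%:R * level J / 16)) = x ^+ 16.
  by rewrite /x -expRM_natl levelS; congr expR; ring.
have hx : x ^+ 16 <= 1 / 2 * x.
  rewrite exprSr; apply: ler_wpM2r => //.
  rewrite exprS; apply: (@le_trans _ _ (x * 1)); last by rewrite mulr1.
  by apply: ler_wpM2l => //; apply: exprn_ile1 => //; lra.
have := IH; rewrite e => /(_ _); lra.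
Qed.

(** With [x = expR (- L)], all failure probabilities together make [10 * x ^+ 4]. This is where the
    confidence bound 1/3 enters: 10/27 is below 1. *)
Lemma pow4_le_tenth (x : R) : 0 <= x -> 3 * x <= 1 ->
  10 * x ^+ 4 <= x /\ x ^+ 4 <= 1 / 2.
Proof.
move=> x0 x3.
have h : x ^+ 2 <= 1 / 3 * x by rewrite expr2; apply: ler_wpM2r => //; lra.
have h3 : x ^+ 3 <= 1 / 9 * x.
  by rewrite exprS; apply: le_trans (ler_wpM2l x0 h) _; rewrite mulrCA -expr2; lra.
have h4 : x ^+ 4 <= 1 / 27 * x.
  by rewrite exprS; apply: le_trans (ler_wpM2l x0 h3) _; rewrite mulrCA -expr2; lra.
by split; lra.
Qed.

(** The four numerical conditions serve, in order: reliability of the pilot, smallness of the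
    extreme tail compared with [t], and the exponents in the second and in the first case of
    [gain_exists]. *)
Lemma split_center_accurate (f : density R) (mu L : R) k m J (r t : R) :
  sym_mhr f -> 3 * expR (- L) <= 1 -> (0 < J)%N -> 0 < r ->
  (t%:E < hellinger2 (translate 0 f) (translate (2 * r) f))%E ->
  64 * L <= m%:R * level J -> 256 * level J <= t ->
  4 * L <= k%:R * ((3 / 2048) ^+ 2 * (level J / 2)) ->
  4 * 64 ^+ 2 * 63 ^+ 2 * (4 * L) <= k%:R * ((3 / 2048) ^+ 2 * (3 / 4) * (t / 2)) ->
  (iid (density_law (translate mu f)) (k + m)
    [set X : (k + m).-tuple R | (r < `|split_center J (take k X) (drop k X) - mu|)%R]
   <= (expR (- L))%:E)%E.
Proof.
move=> K L1 J0 r0 tH mJ tJ kJ kt.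
have [G [mG PG hG]] := @pilot_good _ f mu K m J.
set x := expR (- L) in L1 *.
have x0 : 0 < x by exact: expR_gt0.
have x4 : expR (- (4 * L)) = x ^+ 4 by rewrite /x -expRM_natl mulrN.
have [hx x42] := pow4_le_tenth (ltW x0) L1.
have mA : measurable [set X : (k + m).-tuple (measurableTypeR R) |
    (r < `|split_center J (take k X) (drop k X) - mu|)%R].
  apply: measurable_lt_set; apply: measurableT_comp => //.
  apply: measurable_funB => //.
  by apply: measurable_split_estimator; exact: leq_addr.
(* The 8 is the 4 of [pilot_good] times the 2 of [expR_level_sum]; the other 2 comes from
   [split_center_far]. *)
apply: (@le_trans _ _ (8 * x ^+ 4 + 2 * x ^+ 4)%:E); last first.
  by rewrite lee_fin; apply: le_trans hx; lra.
apply: (iid_cat_le mA mG); first by rewrite mulr_ge0// exprn_ge0// ltW.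
  apply: (le_trans PG); rewrite lee_fin -mulr_sumr.
  have h1 : expR (- (m%:R * level J / 16)) <= x ^+ 4.
    by rewrite -x4 ler_expR; lra.
  have := expR_level_sum (le_trans h1 x42); move: h1.
  move: (expR _) (\sum_(_ < _) _) (x ^+ 4) => u v w.
  by clear; lra.
move=> z /hG[Q /andP[S1 S2]].
have [|r' [r'0 rr rs gain]] := gain_exists K Q J0 r0 tH; first lra.
have b0 : 0 < half_width z 0 by case: Q.
have [A [mA' PA hA]] := split_center_far mu K k b0
  (@grid_lt _ _ _ _ _ (sym_mhr_tail K) Q) r'0 rr rs.
apply: (@le_trans _ _ (iid (density_law (translate mu f)) k A)).
  apply: le_measure; rewrite ?inE//.
    rewrite -[X in measurable X]setTI.
    exact: (measurable_tcatl z) mA.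
  move=> y /=; rewrite take_tcat drop_tcat => hy; apply: contrapT => /hA/andP[h1 h2].
  have := crossing_itv (@balance_nincr _ J y z) h2 (ltW h1).
  rewrite -/(split_center J y z) => /andP[h3 h4].
  by move: hy; rewrite ltNge ler_distl h3 h4.
apply: (le_trans PA); rewrite lee_fin -x4 ler_pM2l// ler_expR lerN2.
case: gain => gain.
- have c0 : 0 < 4 * 64 ^+ 2 * 63 ^+ 2 :> R by rewrite !mulr_gt0 ?exprn_gt0.
  rewrite -(ler_pM2l c0); apply: (le_trans kt).
  by rewrite [leRHS]mulrCA; apply: ler_wpM2l gain; exact: ler0n.
- apply: (le_trans kJ); apply: ler_wpM2l; first exact: ler0n.
  apply: le_trans gain; exact: (ler_wpM2l (ltW kappa_gt0)).
Qed.

End accuracy.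

(** The Hellinger distance is known to exceed [t] only strictly above the modulus; continuity from
    below along [w + i.+1%:R^-1] reaches the modulus itself. *)
Lemma probability_gt_limit d (T : measurableType d) (R : realType)
    (P : probability T R) (g : T -> R) (w e : R) :
  measurable_fun [set: T] g ->
  (forall r : R, (w < r)%R -> P [set x | (r < g x)%R] <= e%:E)%E ->
  (P [set x | (w < g x)%R] <= e%:E)%E.
Proof.
move=> mg h; pose F i := [set x | w + i.+1%:R^-1 < g x].
have mS r : measurable [set x | r < g x] by exact: measurable_lt_set.
have UF : \bigcup_i F i = [set x | w < g x].
  apply/seteqP; split => x /=.
    by move=> [i _ /=]; apply: lt_trans; rewrite ltrDl invr_gt0.
  move=> wg; have [i hi] : exists i, i.+1%:R^-1 < g x - w.
    have gw : 0 < g x - w by rewrite subr_gt0.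
    by have [i _ /(_ _ (leqnn i))] := near_infty_natSinv_lt (PosNum gw); exists i.
  by exists i => //=; rewrite /F/= -ltrBrDl.
have mF i : measurable (F i) by exact: mS.
have ndF : nondecreasing_seq F.
  move=> i j ij; apply/subsetPset => x /=; apply: le_lt_trans.
  by rewrite lerD2l lef_pV2 ?posrE// ler_nat.
have := nondecreasing_cvg_mu (mu := P) mF _ ndF; rewrite UF => /(_ (mS w)) cF.
rewrite -(cvg_lim _ cF)//; apply: lime_le; first by apply/cvg_ex; eexists; exact: cF.
by apply: nearW => i /=; apply: h; rewrite ltrDl invr_gt0.
Qed.

(** [e] is the largest exponent with [16 ^ e <= x], and the predecessor matches the shift in
    [level]. At least [16 ^ 2] is required of [x] to keep [J] positive. *)
Lemma last_level {R : realType} (x : R) : 256 <= x ->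
  let J := (trunc_log 16 (Num.truncn x)).-1 in
  [/\ (0 < J)%N, 1 <= x * level J & x * level J <= 16].
Proof.
move=> x256; have x0 : 0 <= x by apply: le_trans x256; exact: ler0n.
set e := trunc_log _ _.
have M256 : (16 ^ 2 <= Num.truncn x)%N by rewrite truncn_ge_nat.
have e2 : (2 <= e)%N by apply: trunc_log_max.
have /andP[h1 h2] := truncn_itv x0.
have h3 : (16 ^ e <= Num.truncn x)%N by apply: trunc_logP => //; apply: leq_trans M256.
have h4 : (Num.truncn x < 16 ^ e.+1)%N by apply: trunc_log_ltn.
split; first by rewrite -ltnS prednK// ltnW.
  rewrite /level prednK ?(ltnW e2)// exprVn ler_pdivlMr ?exprn_gt0// mul1r.
  by rewrite (le_trans _ h1)// -natrX ler_nat.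
rewrite /level prednK ?(ltnW e2)// exprVn ler_pdivrMr ?exprn_gt0// -exprS.
by rewrite (le_trans (ltW h2))// -natrX ler_nat.
Qed.

(** * Choice of the constants *)

Section constants.
Context {R : realType}.

(** The 8 makes the third condition of [split_conditions] follow from [pilot_constant * L <= m * p]
    and [m <= k]. *)
Definition pilot_constant : R := 8 / (3 / 2048) ^+ 2.
(** The 64 and 63 come from [hellinger2_le] and [grid_hazard_le]; the last condition of
    [split_conditions] then asks for a factor of at least 32 / 3, hence 11. *)
Definition rate_constant : R := pilot_constant * (64 ^+ 2 * 63 ^+ 2 * 11).

Lemma pilot_constant_gt0 : 0 < pilot_constant.
Proof. by apply: divr_gt0; [rewrite ltr0n|exact: kappa_gt0]. Qed.

Lemma kappa_pilot_constant : (3 / 2048) ^+ 2 * pilot_constant = 8.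
Proof. by rewrite /pilot_constant mulrC; exact: (divfK (lt0r_neq0 kappa_gt0)). Qed.

Lemma pilot_constant_ge : 64 <= pilot_constant.
Proof.
rewrite ler_pdivlMr ?kappa_gt0//; apply: (@le_trans _ _ (64 * (1 / 8))); last lra.
rewrite ler_pM2l ?ltr0n//; lra.
Qed.

Lemma rate_constant_gt0 : 0 < rate_constant.
Proof. by apply: mulr_gt0; [exact: pilot_constant_gt0|lra]. Qed.

Lemma split_conditions (L n k m p : R) : 0 < L -> n = k + m -> m <= k -> k <= 2 * m ->
  rate_constant * L <= n -> 0 < m ->
  pilot_constant * L <= m * p -> m * p <= 16 * (pilot_constant * L) ->
  let t := rate_constant * L / n in
  [/\ 64 * L <= m * p, 256 * p <= t,
      4 * L <= k * ((3 / 2048) ^+ 2 * (p / 2)) &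
      4 * 64 ^+ 2 * 63 ^+ 2 * (4 * L) <= k * ((3 / 2048) ^+ 2 * (3 / 4) * (t / 2))].
Proof.
rewrite /rate_constant.
move: pilot_constant_ge kappa_pilot_constant (@kappa_gt0 R).
generalize pilot_constant ((3 / 2048) ^+ 2 : R).
move=> q c q64 cq c0 L0 nkm mk km Ln m0 h1 h2; set t := _ * L / n.
have n0 : 0 < n by lra.
have q0 : 0 < q by lra.
have tn : t * n = q * (64 ^+ 2 * 63 ^+ 2 * 11) * L by rewrite /t divfK// gt_eqF.
have t0 : 0 <= t by rewrite /t divr_ge0 ?(ltW n0)// !mulr_ge0 ?(ltW q0) ?(ltW L0).
clearbody t.
have qL : 64 * L <= q * L by rewrite ler_pM2r.
split.
- lra.
- rewrite -(ler_pM2r n0) tn.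
  have p0 : 0 < p by rewrite -(pmulr_rgt0 _ m0); lra.
  have h3 : p * n <= p * (3 * m) by rewrite ler_pM2l//; lra.
  clear tn; lra.
- have p0 : 0 < p by rewrite -(pmulr_rgt0 _ m0); lra.
  apply: (@le_trans _ _ (m * (c * (p / 2)))).
    have := ler_wpM2l (ltW c0) h1; rewrite [c * (q * L)]mulrA cq => h3; clear tn; lra.
  by apply: ler_wpM2r => //; rewrite mulr_ge0 ?divr_ge0 ?(ltW c0) ?(ltW p0).
- apply: (@le_trans _ _ (n / 2 * (c * (3 / 4) * (t / 2)))); last first.
    apply: ler_wpM2r; last lra.
    by rewrite !mulr_ge0 ?(ltW c0)// divr_ge0.
  have -> : n / 2 * (c * (3 / 4) * (t / 2)) = 3 / 16 * (c * (t * n)) by field.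
  have -> : c * (t * n) = 8 * (64 ^+ 2 * 63 ^+ 2 * 11) * L by rewrite tn !mulrA cq.
  clear - L0; lra.
Qed.

End constants.

(** * From the Hellinger distance to its inverse modulus *)

Section modulus.
Context {R : realType}.
Implicit Type f : density R.

Lemma inv_hellinger_modulus_ge0 f t : 0 <= t -> (0 <= inv_hellinger_modulus f t)%E.
Proof.
move=> t0; apply: ereal_sup_ubound; exists 0 => //; split => //.
rewrite /hellinger2 integral0_eq; first by rewrite mule0 lee_fin.
by move=> x _; rewrite /= mulr0 subrr expr0n.
Qed.

Lemma inv_hellinger_modulus_lt f t (r : R) : 0 <= r ->
  (inv_hellinger_modulus f t < r%:E)%E ->
  (t%:E < hellinger2 (translate 0 f) (translate (2 * r) f))%E.
Proof.
move=> r0 wr; rewrite ltNge; apply/negP => h.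
move: wr; rewrite ltNge => /negP; apply; apply: ereal_sup_ubound.
by exists r.
Qed.

Lemma probability_le_modulus d (T : measurableType d) (P : probability T R)
    (g : T -> R) f t (e : R) : measurable_fun [set: T] g -> 0 <= t -> 0 <= e ->
  (forall r, 0 < r -> (t%:E < hellinger2 (translate 0 f) (translate (2 * r) f))%E ->
     (P [set x | (r < g x)%R] <= e%:E)%E) ->
  ((1 - e)%:E <= P [set x | ((g x)%:E <= inv_hellinger_modulus f t)%E])%E.
Proof.
move=> mg t0 e0 h; have := inv_hellinger_modulus_ge0 f t0.
have := @inv_hellinger_modulus_lt f t.
case: (inv_hellinger_modulus f t) => [w|_ _|_]; last by rewrite leeNy_eq.
- move=> ht; rewrite lee_fin => w0.
  have hw : (P [set x | (w < g x)%R] <= e%:E)%E.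
    apply: probability_gt_limit => // r wr; apply: h; first exact: le_lt_trans wr.
    by apply: ht; [exact: le_trans (ltW wr)|rewrite lte_fin].
  have -> : [set x | ((g x)%:E <= w%:E)%E] = ~` [set x | (w < g x)%R].
    by apply/seteqP; split => x /=; rewrite lee_fin leNgt => /negP.
  rewrite probability_setC; first by rewrite EFinB; exact: leeB.
  exact: measurable_lt_set.
- rewrite (_ : [set _ | _] = [set: T]); last by apply/seteqP; split => x //= _; rewrite leey.
  by rewrite probability_setT lee_fin gerBl.
Qed.

End modulus.

(** * The location estimator and the theorem *)

Section location_estimator.
Context {R : realType}.

Definition main_size (n : nat) : nat := n - n./2.

Lemma main_size_bounds n : (1 < n)%N ->
  [/\ n = main_size n + n./2, 0 < n./2, n./2 <= main_size n & main_size n <= 2 * n./2]%N.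
Proof. by rewrite /main_size => n2; have := odd_double_half n; split; lia. Qed.

(** For large [n], the deepest level at which the pilot half still expects [pilot_constant * L]
    points. It depends on [n] and [L] alone, not on the density. *)
Definition level_count (L : R) (n : nat) : nat :=
  (trunc_log 16 (Num.truncn ((n./2)%:R / (pilot_constant * L)))).-1.

Definition location_estimator (L : R) (n : nat) (X : n.-tuple R) : R :=
  split_center (level_count L n) (take (main_size n) X) (drop (main_size n) X).

Lemma measurable_location_estimator (L : R) n :
  measurable_fun [set: n.-tuple (measurableTypeR R)] (@location_estimator L n).
Proof. by apply: measurable_split_estimator; exact: leq_subr. Qed.

Lemma location_estimator_accurate (f : density R) (mu L : R) n (r : R) :
  sym_mhr f -> 3 * expR (- L) <= 1 -> rate_constant * L <= n%:R -> 0 < r ->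
  ((rate_constant * L / n%:R)%:E < hellinger2 (translate 0 f) (translate (2 * r) f))%E ->
  (iid (density_law (translate mu f)) n
    [set X : n.-tuple R | (r < `|location_estimator L X - mu|)%R] <= (expR (- L))%:E)%E.
Proof.
move=> K L1 Ln r0 tH.
have L0 : 2 / 3 <= L by have := expR_ge1Dx (- L); lra.
have Lp : 0 < L by lra.
have q0 := @pilot_constant_gt0 R; have q64 := @pilot_constant_ge R.
have qL : 64 * L <= pilot_constant * L by rewrite ler_pM2r.
have n3072 : 3072 * (pilot_constant * L) <= n%:R.
  apply: le_trans Ln; rewrite /rate_constant [_ * _ * L]mulrAC [leRHS]mulrC.
  apply: ler_wpM2r; last by clear; lra.
  by rewrite mulr_ge0 ?(ltW q0) ?(ltW Lp).
have n2 : (1 < n)%N.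
  rewrite -(@ltr_nat R); clear - qL n3072 L0; move: (pilot_constant * L) qL n3072 => z; lra.
set m := n./2; set k := main_size n.
have [nkm m1 mk k2] : [/\ n = k + m, 0 < m, m <= k & k <= 2 * m]%N := main_size_bounds n2.
have x256 : 256 <= m%:R / (pilot_constant * L).
  rewrite ler_pdivlMr; last by rewrite mulr_gt0.
  have : n%:R <= 3 * m%:R :> R.
    rewrite -natrM ler_nat nkm -[leqRHS]/((1 + 2) * m)%N.
    by rewrite mulnDl mul1n addnC leq_add2l.
  have := mulr_gt0 q0 Lp; move: n3072; clear; move: (pilot_constant * L) => z; lra.
have [J0 J1 J2] := last_level x256.
rewrite -/m -/(level_count L n) in J0 J1 J2.
have qL0 : 0 < pilot_constant * L by rewrite mulr_gt0.
have h1 : pilot_constant * L <= m%:R * level (level_count L n).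
  by move: J1; rewrite mulrAC ler_pdivlMr// mul1r.
have h2 : m%:R * level (level_count L n) <= 16 * (pilot_constant * L).
  by move: J2; rewrite mulrAC ler_pdivrMr.
have nkm' : n%:R = k%:R + m%:R :> R by rewrite -natrD -nkm.
have mk' : m%:R <= k%:R :> R by rewrite ler_nat.
have k2' : k%:R <= 2 * m%:R :> R by rewrite -natrM ler_nat.
have m0 : 0 < m%:R :> R by rewrite ltr0n.
have [c1 c2 c3 c4] := split_conditions Lp nkm' mk' k2' Ln m0 h1 h2.
rewrite /location_estimator -/k.
move: (level_count L n) J0 c1 c2 c3 c4 tH => J J0 c1 c2 c3 c4 tH.
have := split_center_accurate mu K L1 J0 r0 tH c1 c2 c3 c4.
by rewrite -nkm.
Qed.

End location_estimator.

Unset Implicit Arguments.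
Set Strict Implicit.

Theorem theorem1 (R : realType) :
  exists C C' : R, [/\ 0 < C, 0 < C', C <= C' &
    forall delta : R, 0 < delta <= 1 / 3 ->
    exists2 muhat : forall n : nat, n.-tuple (measurableTypeR R) -> R,
      forall n : nat, measurable_fun [set: n.-tuple (measurableTypeR R)] (muhat n) &
      forall f : density R, (SLC `|` SUMHR) f ->
      forall n : nat, C' * ln (1 / delta) <= n%:R ->
      ((1 - delta)%:E <= ereal_inf [set
         iid (density_law (translate mu f)) n
           [set X | `|muhat n X - mu|%:E <=
                    inv_hellinger_modulus f (C * ln (1 / delta) / n%:R)]
       | mu in [set: R]])%E].
Proof.
(* Equal constants keep the argument of the modulus at most 1 on the whole range of [n]. *)
exists rate_constant, rate_constant.
split; [exact: rate_constant_gt0|exact: rate_constant_gt0|exact: lexx|].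
move=> delta /andP[d0 d1]; set L := ln (1 / delta).
have dL : expR (- L) = delta.
  by rewrite /L div1r lnV ?posrE// opprK lnK.
have L0 : 0 <= L.
  by rewrite /L ln_ge0// ler_pdivlMr// mul1r; lra.
exists (@location_estimator R L); first exact: measurable_location_estimator.
move=> f fc n hn.
have K : sym_mhr f by case: fc => [/SLC_sym_mhr|/SUMHR_sym_mhr].
apply: le_ereal_inf_tmp => _ [mu _ <-].
apply: (@probability_le_modulus _ _ _ (iid (density_law (translate mu f)) n)
   (fun X => `|location_estimator L X - mu|)).
- apply: measurableT_comp => //; apply: measurable_funB => //.
  exact: measurable_location_estimator.
- by rewrite divr_ge0// mulr_ge0// ltW// rate_constant_gt0.
- exact: ltW.
- move=> r r0 tH; rewrite -dL; apply: location_estimator_accurate => //.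
  by rewrite dL; lra.
Qed.
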